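(* Let $K$ be a field of prime characteristic $p>0$, let $L=K(\theta)\simeq K[x]/(f(x))$ be a simple finite field extension of $K$, where $f(x)=f^{sep}(x^{p^n})=\sum_{i=0}^s\lambda_i x^{ip^n}\in K[x]$ (with $\lambda_i\in K$, $\lambda_s=1$) is the monic irreducible minimal polynomial of $\theta$ over $K$, written in its separable presentation, and let $N/K$ be a purely inseparable field extension. Write $(NL)^{sep}:=(NL/N)^{sep}$, $(NL)^{pi}:=(NL/N)^{pi}$, $m_1:=m_{f,N}$ and $m_2:=m_{f,N(\theta)}$. Then: 1. $(NL)^{sep}=NL^{sep}=N(\theta^{p^{n-m_1}})\simeq N[x]/(f_N^{sep})$, $[NL^{sep}:N]=\deg(f_N^{sep})=s$, and $f_N^{sep}(x)$ is a monic irreducible polynomial in $N[x]$ which is the minimal polynomial of $\theta^{p^{n-m_1}}$ over $N$. 2. $(NL)^{pi}=N\big(\lambda_0^{1/p^{m_1+m_2}},\ldots,\lambda_{s-1}^{1/p^{m_1+m_2}}\big)\supseteq NL^{pi}=N\big(\lambda_0^{1/p^{m_1}},\ldots,\lambda_{s-1}^{1/p^{m_1}}\big)$, $[(NL)^{pi}:N]=p^{m_2}$, and $$m_2=\max\{m'\in\{0,1,\ldots,n-m_1\}\mid \theta^{p^{n-m_1-m'}}\in (NL)^{pi}(NL)^{sep}\}$$ $$=\max\{m'\in\{0,1,\ldots,n-m_1\}\mid (NL)^{p^{n-m_1-m'}}\subseteq (NL)^{pi}(NL)^{sep}\}.$$ In particular, $m_2=m_{f,N(\theta)}$ is an isomorphism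 invariant of the field extension $NL/N$. 3. $(NL)^{pi}(NL)^{sep}=(NL)^{pi}\otimes_N(NL)^{sep}=(NL)^{pi}\big(\theta^{p^{n-m_1-m_2}}\big)\simeq (NL)^{pi}[x]/(f_{NL}^{sep})$, $[(NL)^{pi}(NL)^{sep}:(NL)^{pi}]=s$, $[(NL)^{pi}(NL)^{sep}:(NL)^{sep}]=p^{m_2}$, and $f_{NL}^{sep}=\sum_{i=0}^s\lambda_i^{1/p^{m_1+m_2}}x^i$ is a monic irreducible polynomial in $(NL)^{pi}[x]$ which is the minimal polynomial of $\theta^{p^{n-m_1-m_2}}$ over $(NL)^{pi}$. 4. With $E:=(NL)^{pi}(NL)^{sep}=(NL)^{pi}\otimes_N(NL)^{sep}$, one has $NL=E(\theta)\simeq E[x]/\big(x^{p^{n-m_1-m_2}}-\theta^{p^{n-m_1-m_2}}\big)$, $[NL:E]=p^{n-m_1-m_2}$, and $x^{p^{n-m_1-m_2}}-\theta^{p^{n-m_1-m_2}}$ is a monic irreducible polynomial in $E[x]$ which is the minimal polynomial of $\theta$ over $E$. The finite field extension $NL/E$ is a simple purely inseparable extension of exponent $n-m_1-m_2$. 5. $\big(NL/(NL)^{pi}\big)^{sep}=(NL)^{pi}(NL)^{sep}/(NL)^{pi}$, i.e. the maximal separable subextension of $NL/(NL)^{pi}$ is $(NL)^{pi}(NL)^{sep}/(NL)^{pi}$.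
   Context: Fix an algebraic closure $\overline{K}$ of $K$ containing all fields considered (in particular $L$ and $N$); $AB$ denotes the compositum in $\overline{K}$, and $NL=N(\theta)$. In particular $NL^{sep}$ and $NL^{pi}$ denote the composita of $N$ with $L^{sep}$ and with $L^{pi}$. The extension $N/K$ is not assumed finite. For $\lambda\in\overline{K}$ and $k\ge 0$, $\lambda^{1/p^k}$ denotes the unique $p^k$-th root of $\lambda$ in $\overline{K}$. For an algebraic extension $E/F$, $(E/F)^{sep}$ and $(E/F)^{pi}$ are its maximal separable and maximal purely inseparable subextensions; $L^{sep}:=(L/K)^{sep}$ and $L^{pi}:=(L/K)^{pi}$. The equality $(NL)^{pi}(NL)^{sep}=(NL)^{pi}\otimes_N(NL)^{sep}$ means that the natural map $a\otimes b\mapsto ab$ is an isomorphism. For a field $E$, $E^{p^k}=\{e^{p^k}\mid e\in E\}$. The exponent of a finite purely inseparable extension $E/F$ is the least $e\ge 0$ with $E^{p^e}\subseteq F$. Separable presentation: every non-scalar $f\in K[x]$ considered is written uniquely as $f(x)=f^{sep}(x^{p^n})$ with $f^{sep}\in K[x]$ a separable polynomial and $n\ge 0$; $n$ is the inseparability degree of $f$. Here $f^{sep}(x)=\sum_{i=0}^s\lambda_i x^i$. Definitions of the numbers and polynomials: - $m_{f,N}:=\max\{m'\in\{0,\ldots,n\}\mid \lambda_i^{1/p^{m'}}\in N\text{ for all }i=0,\ldots,s-1\}$; - $m_{f,N(\theta)}:=\max\{m'\in\{0,\ldots,n-m_{f,N}\}\mid \lambda_i^{1/p^{m_{f,N}+m'}}\in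 NL\text{ for all }i=0,\ldots,s-1\}$; - $f_N^{sep}(x):=\sum_{i=0}^s\lambda_i^{1/p^{m_{f,N}}}x^i\in N[x]$; - $f_{NL}^{sep}(x):=\sum_{i=0}^s\lambda_i^{1/p^{m_{f,N}+m_{f,N(\theta)}}}x^i$.
   Formalization: In item 2 the equality NL^pi = N(λ_i^{1/p^{m_1}}) is false (K=N=F_p(t), θ=t^{1/p}); it is replaced by NL^pi = N(λ_i^{1/p^m}) with m = m_{f,K}+m_{f,K(θ)}, together with the inclusion N(λ_i^{1/p^{m_1}}) ⊆ NL^pi. *)

(* Defs.v *)
From HB Require Import structures.
From mathcomp Require Import all_boot all_order all_algebra falgebra fieldext separable.
From mathcomp Require Import boolp.

Set Implicit Arguments.
Unset Strict Implicit.
Unset Printing Implicit Defensive.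

Import GRing.Theory.
Local Open Scope ring_scope.
Local Open Scope quotient_scope.

(** Subfields of a fixed big field [T] are the predicates of type
    [divringClosed T]; two of them are compared with [=i]. *)

Section SubfieldType.
Variables (T : fieldType) (F : divringClosed T).

Record fld := Fld { fld_val : T; fld_valP : fld_val \in F }.

HB.instance Definition _ := [isSub for fld_val].
HB.instance Definition _ := [Choice of fld by <:].
HB.instance Definition _ := [SubChoice_isSubComUnitRing of fld by <:].
HB.instance Definition _ := [SubComUnitRing_isSubIntegralDomain of fld by <:].
HB.instance Definition _ := [SubIntegralDomain_isSubField of fld by <:].

End SubfieldType.

Section Generation.
Variable T : fieldType.
Implicit Types (F E : divringClosed T) (A : T -> Prop).

Definition gen_pred A : pred T :=
  fun x => `[< forall S : divringClosed T, (forall y, A y -> y \in S) -> x \in S >].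

Fact gen_divring_closed A : divring_closed (gen_pred A).
Proof.
split=> [|x y /asboolP Ax /asboolP Ay|x y /asboolP Ax /asboolP Ay];
  apply/asboolP=> S AS.
- exact: rpred1.
- by apply: rpredB; [apply: Ax | apply: Ay].
- by apply: rpred_div; [apply: Ax | apply: Ay].
Qed.

HB.instance Definition _ A :=
  GRing.isDivringClosed.Build T (gen_pred A) (gen_divring_closed A).

Definition gen_field A : divringClosed T :=
  GRing.DivringClosed.clone T (gen_pred A) _.

Definition adjoin F A : divringClosed T :=
  gen_field (fun y => y \in F \/ A y).

Definition adjoin1 F (x : T) : divringClosed T := adjoin F (eq^~ x).

Definition compositum F E : divringClosed T :=
  adjoin F (fun y => y \in E).

End Generation.

Section Extensions.
Variable T : fieldType.
Implicit Types (F E M : divringClosed T) (x : T).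

Definition minimal_polynomial F x (g : {poly fld F}) : Prop :=
  [/\ g \is monic, root (map_poly val g) x
    & forall h : {poly fld F}, root (map_poly val h) x -> g %| h].

Definition separable_over F x : Prop :=
  exists2 g : {poly fld F}, minimal_polynomial x g & separable_poly g.

Definition separable_ext F E : Prop :=
  {in E, forall x, separable_over F x}.

Definition purely_insep_ext (p : nat) F E : Prop :=
  {in E, forall x, exists k, x ^+ (p ^ k) \in F}.

Definition largest_subext (P : divringClosed T -> divringClosed T -> Prop)
    F E M : Prop :=
  [/\ {subset F <= M}, {subset M <= E}, P F M
    & forall M' : divringClosed T,
        {subset F <= M'} -> {subset M' <= E} -> P F M' -> {subset M' <= M}].

(** Such an [M] is unique up to [=i], and exists in both cases used below, by
    [max_sepP] and [max_piP]. *)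
Definition max_subext P F E : divringClosed T :=
  if pselect (exists M, largest_subext P F E M) is left exM
  then projT1 (cid exM) else F.

Lemma max_subextP P F E :
  (exists M, largest_subext P F E M) ->
  largest_subext P F E (max_subext P F E).
Proof. by rewrite /max_subext; case: pselect => // exM _; case: cid. Qed.

Definition max_sep F E := max_subext separable_ext F E.
Definition max_pi p F E := max_subext (purely_insep_ext p) F E.

Definition ext_degree F E (d : nat) : Prop :=
  {subset F <= E} /\
  exists2 b : 'I_d -> T, forall i, b i \in E
    & forall y, y \in E ->
        exists! c : {ffun 'I_d -> fld F}, y = \sum_i val (c i) * b i.

Definition pi_exponent (p : nat) F E (e : nat) : Prop :=
  (forall x, x \in E -> x ^+ (p ^ e) \in F) /\
  (forall e', (forall x, x \in E -> x ^+ (p ^ e') \in F) -> (e <= e')%N).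

(** [F[X]/(g)] is isomorphic to [E], by an isomorphism which is the identity
    on [F] and maps the class of ['X] to [x]. *)
Definition quotient_iso F (g : {poly fld F}) E x : Prop :=
  exists phi : {rmorphism {poly %/ g} -> fld E},
    [/\ bijective phi, forall c, val (phi (qpolyC g c)) = val c
      & val (phi (qpolyX g)) = x].

(** The polynomial [h] over [T] has its coefficients in [F], is monic and
    irreducible over [F], is the minimal polynomial of [x] over [F], and
    presents [E] as [F[X]/(h)] with [x] the class of ['X]. *)
Definition presented_by F (h : {poly T}) x E : Prop :=
  exists g : {poly fld F},
    [/\ map_poly val g = h, g \is monic, irreducible_poly g,
        minimal_polynomial x g & quotient_iso g E x].

End Extensions.

Lemma irr_root (F0 L : fieldType) (iota : {rmorphism F0 -> L}) y (h : {poly F0}) :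
  h != 0 -> root (map_poly iota h) y ->
  exists2 q : {poly F0}, irreducible_poly q & root (map_poly iota q) y.
Proof.
move=> nz_h rh.
have ex : exists m, `[< exists q : {poly F0}, [/\ q != 0, root (map_poly iota q) y & size q = m] >].
  by exists (size h); apply/asboolP; exists h.
case: (ex_minnP ex) => m /asboolP [q [nzq rq sq]] mq.
exists q => //; apply/(subfx_irreducibleP rq nzq) => r rr nzr.
by rewrite sq; apply: mq; apply/asboolP; exists r.
Qed.

Lemma two_step (T : fieldType) (F : divringClosed T) x y (gx gy : {poly fld F}) :
  gx != 0 -> root (map_poly val gx) x -> gy != 0 -> root (map_poly val gy) y ->
  exists (L : fieldExtType (fld F)) (iota : {rmorphism L -> T}) X Y,
   [/\ iota X = x, iota Y = y & forall a, iota a%:A = val a].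
Proof.
move=> nzx rx nzy ry.
pose iF : {rmorphism fld F -> T} := val.
have [px ix rpx] := irr_root (iota := iF) nzx rx.
pose L1 := SubFieldExtType rpx ix.
pose i1 : {rmorphism L1 -> T} := subfx_inj (iota:=iF) (z:=x) (p:=px).
have nzpx := irredp_neq0 ix.
have i1A a : i1 a%:A = val a by exact: (subfx_inj_base rpx nzpx).
have nzy1 : map_poly (in_alg L1) gy != 0 by rewrite map_poly_eq0.
have ry1 : root (map_poly i1 (map_poly (in_alg L1) gy)) y.
  by rewrite -map_poly_comp (eq_map_poly i1A).
have [py iy rpy] := irr_root nzy1 ry1.
pose L2 := SubFieldExtType rpy iy.
pose i2 : {rmorphism L2 -> T} := subfx_inj (iota:=i1) (z:=y) (p:=py).
have nzpy := irredp_neq0 iy.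
have i2A (a : L1) : i2 a%:A = i1 a by exact: (subfx_inj_base rpy nzpy).
exists (baseFieldType L2), i2, ((subfx_root iF x px : L1)%:A : L2), (subfx_root i1 y py).
split.
- rewrite i2A; exact: (subfx_inj_root rpx nzpx).
- exact: (subfx_inj_root rpy nzpy).
- by move=> a; rewrite baseField_scaleE i2A i1A.
Qed.

Lemma min_polyP (T : fieldType) (F : divringClosed T) x (h : {poly fld F}) :
  h != 0 -> root (map_poly val h) x ->
  exists g : {poly fld F}, minimal_polynomial x g.
Proof.
move=> nzh rh; pose iF : {rmorphism fld F -> T} := val.
have [q iq rq] := irr_root (iota := iF) nzh rh.
have nzq := irredp_neq0 iq.
have lc : lead_coef q != 0 by rewrite lead_coef_eq0.
exists ((lead_coef q)^-1 *: q); split.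
- by rewrite monicE lead_coefZ mulVf.
- by rewrite map_polyZ rootZ // fmorph_eq0 invr_eq0.
move=> r rr; rewrite dvdpZl ?invr_eq0 //.
have nc : size (gcdp q r) != 1.
  rewrite -(size_map_poly iF) gcdp_map gtn_eqF //.
  apply: (@root_size_gt1 _ x); last by rewrite root_gcd rq.
  by rewrite gcdp_eq0 map_poly_eq0 (negPf nzq).
by rewrite -(eqp_dvdl _ (iq.2 _ nc (dvdp_gcdl _ _))) dvdp_gcdr.
Qed.

Lemma sep_overP (T : fieldType) (F : divringClosed T) x (h : {poly fld F}) :
  separable_poly h -> root (map_poly val h) x -> separable_over F x.
Proof.
move=> sh rh; have [g mg] := min_polyP (separable_poly_neq0 sh) rh.
by exists g => //; apply: dvdp_separable sh; case: mg => _ _; apply.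
Qed.

Lemma sep_closed (T : fieldType) (F : divringClosed T) x y :
  separable_over F x -> separable_over F y ->
  separable_over F (x - y) /\ separable_over F (x / y).
Proof.
move=> [gx [_ rx _] sx] [gy [_ ry _] sy].
have [L [i [X [Y [iX iY iA]]]]] :=
  two_step (separable_poly_neq0 sx) rx (separable_poly_neq0 sy) ry.
have emap (h : {poly fld F}) : map_poly i (map_poly (in_alg L) h) = map_poly val h.
  by rewrite -map_poly_comp (eq_map_poly iA).
have sepL Z (h : {poly fld F}) : separable_poly h -> root (map_poly val h) (i Z) -> separable_element 1%VS Z.
  move=> sh rh; apply/separable_elementP; exists (map_poly (in_alg L) h).
  split; first by apply/polyOver1P; exists h.
    by rewrite -(fmorph_root i) emap.
  by rewrite separable_map.
have sX : separable_element 1%VS X by apply: (sepL X gx); rewrite ?iX.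
have sY : separable_element 1%VS Y by apply: (sepL Y gy); rewrite ?iY.
have back Z : separable_element 1%VS Z -> separable_over F (i Z).
  move=> /separable_elementP[h [/polyOver1P[h0 ->] rh sh]].
  apply: (@sep_overP _ _ _ h0); first by rewrite separable_map in sh.
  by rewrite -emap fmorph_root.
have [z defKz] := Primitive_Element_Theorem X sY.
have sz : separable_element 1%VS z.
  move: (sX) => /(separable_elementS (subv_adjoin 1%AS Y)) sXY.
  apply: adjoin_separable sY (adjoin_separable sXY _).
  by rewrite defKz base_separable ?memv_adjoin.
have [Xz Yz] : X \in <<1; z>>%VS /\ Y \in <<1; z>>%VS.
  by rewrite -defKz memv_adjoin subvP_adjoin // memv_adjoin.
rewrite -iX -iY -rmorphB -fmorph_div /=.
split; apply: back; apply: (adjoin_separableP sz); first exact: rpredB.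
exact: rpred_div.
Qed.

Lemma sep_over_base (T : fieldType) (F : divringClosed T) x :
  x \in F -> separable_over F x.
Proof.
move=> Fx; apply: (@sep_overP _ _ _ ('X - (Fld Fx)%:P)).
  by rewrite unlock !derivCE coprimep1.
by rewrite map_polyXsubC root_XsubC.
Qed.

Lemma largest_subext_closed (T : fieldType) P0 (F E : divringClosed T)
    (P := fun F E : divringClosed T => {in E, forall x, P0 F x}) :
  {subset F <= E} -> {in F, forall x, P0 F x} ->
  (forall x y, P0 F x -> P0 F y -> P0 F (x - y) /\ P0 F (x / y)) ->
  largest_subext P F E (max_subext P F E).
Proof.
move=> sFE PF Pclosed; apply: max_subextP.
pose S : pred T := fun x => (x \in E) && `[< P0 F x >].
have SP x : x \in S = (x \in E) && `[< P0 F x >] by [].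
have clS : divring_closed S.
  split=> [|x y|x y]; rewrite !SP.
  - by rewrite rpred1; apply/asboolP/PF/rpred1.
  - move=> /andP[Ex /asboolP Px] /andP[Ey /asboolP Py].
    by rewrite rpredB //; apply/asboolP; case: (Pclosed x y).
  - move=> /andP[Ex /asboolP Px] /andP[Ey /asboolP Py].
    by rewrite rpred_div //; apply/asboolP; case: (Pclosed x y).
pose mS := GRing.isDivringClosed.Build T S clS.
pose M : divringClosed T := HB.pack S mS.
exists M; split=> [x Fx|x|x|M' _ sM'E PM' x M'x].
- by rewrite [x \in M]SP sFE //; apply/asboolP/PF.
- by rewrite [x \in M]SP => /andP[].
- by rewrite [x \in M]SP => /andP[_ /asboolP].
- by rewrite [x \in M]SP sM'E //; apply/asboolP/PM'.
Qed.

Lemma max_sepP (T : fieldType) (F E : divringClosed T) :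
  {subset F <= E} -> largest_subext (@separable_ext T) F E (max_sep F E).
Proof.
move=> sFE; apply: (@largest_subext_closed _ (@separable_over T)) => //.
- exact: sep_over_base.
- exact: sep_closed.
Qed.

Lemma max_piP (T : fieldType) p (F E : divringClosed T) :
  p \in [pchar T] -> {subset F <= E} ->
  largest_subext (@purely_insep_ext T p) F E (max_pi p F E).
Proof.
move=> pT sFE.
apply: (@largest_subext_closed _ (fun F x => exists k, x ^+ (p ^ k) \in F)) => //.
  by move=> x Fx; exists 0%N.
move=> x y [k Fx] [l Fy].
have Fxy : x ^+ (p ^ (k + l)) \in F /\ y ^+ (p ^ (k + l)) \in F.
  split; first by rewrite expnD exprM rpredX.
  by rewrite addnC expnD exprM rpredX.
have pn : [pchar T].-nat (p ^ (k + l))%N by rewrite pnatX pnatE ?(pcharf_prime pT) // pT.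
case: Fxy => Fx' Fy'; split; exists (k + l)%N; last by rewrite expr_div_n rpred_div.
by rewrite exprDn_pchar // exprNn_pchar // rpredB.
Qed.

(** The tensor product over [F] of two extensions [A], [B] of [F] inside [T]:
    formal sums of pairs, modulo the congruence generated by the bilinearity
    relations.  Scalars of [F] act on [A] and [B] by the product of [T]. *)
Section Tensor.
Variables (T : fieldType) (F A B : divringClosed T).

Inductive tens_eq : seq (fld A * fld B) -> seq (fld A * fld B) -> Prop :=
| tens_refl s : tens_eq s s
| tens_sym s t : tens_eq s t -> tens_eq t s
| tens_trans s t u : tens_eq s t -> tens_eq t u -> tens_eq s u
| tens_perm s t : perm_eq s t -> tens_eq s t
| tens_cat s s' t t' :
    tens_eq s s' -> tens_eq t t' -> tens_eq (s ++ t) (s' ++ t')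
| tens_zero b : tens_eq [:: (0, b)] [::]
| tens_addl a a' b : tens_eq [:: (a + a', b)] [:: (a, b); (a', b)]
| tens_addr a b b' : tens_eq [:: (a, b + b')] [:: (a, b); (a, b')]
| tens_scal (c : fld F) (a ca : fld A) (b cb : fld B) :
    val ca = val c * val a -> val cb = val c * val b ->
    tens_eq [:: (ca, b)] [:: (a, cb)].

Definition tens_eqb : rel (seq (fld A * fld B)) :=
  fun s t => `[< tens_eq s t >].

Fact tens_eqb_refl : reflexive tens_eqb.
Proof. by move=> s; apply/asboolP; apply: tens_refl. Qed.

Fact tens_eqb_sym : symmetric tens_eqb.
Proof. by move=> s t; apply/asboolP/asboolP; apply: tens_sym. Qed.

Fact tens_eqb_trans : transitive tens_eqb.
Proof.
by move=> t s u /asboolP st /asboolP tu; apply/asboolP; apply: tens_trans tu.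
Qed.

Canonical tens_equiv :=
  EquivRel tens_eqb tens_eqb_refl tens_eqb_sym tens_eqb_trans.

Definition tensor := {eq_quot tens_equiv}.

Definition pure_tensor (a : fld A) (b : fld B) : tensor := \pi [:: (a, b)].

Definition tens_sum (s : seq (fld A * fld B)) : T :=
  \sum_(ab <- s) val ab.1 * val ab.2.

(** The natural map sending the class of a formal sum to the sum of products;
    it does not depend on the representative by [tensor_mulE]. *)
Definition tensor_mul (u : tensor) : T := tens_sum (repr u).

Lemma tens_sum_eq s t : tens_eq s t -> tens_sum s = tens_sum t.
Proof.
elim=> {s t}; rewrite /tens_sum //.
- by move=> s t u _ -> _ ->.
- by move=> s t /(perm_big _) ->.
- by move=> s s' t t' _ es _ et; rewrite !big_cat /= es et.
- by move=> b; rewrite big_seq1 big_nil /= mul0r.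
- by move=> a a' b; rewrite big_seq1 big_cons big_seq1 /= mulrDl.
- by move=> a b b'; rewrite big_seq1 big_cons big_seq1 /= mulrDr.
- by move=> c a ca b cb /= eca ecb; rewrite !big_seq1 /= eca ecb mulrCA mulrA.
Qed.

Lemma tensor_mulE s : tensor_mul (\pi_tensor s) = tens_sum s.
Proof.
by apply: tens_sum_eq; apply/asboolP; apply/(@eqmodP _ tens_equiv); rewrite reprK.
Qed.

Lemma tensor_mul_pure a b : tensor_mul (pure_tensor a b) = val a * val b.
Proof. by rewrite tensor_mulE /tens_sum big_seq1. Qed.

(** The natural map sends the pure tensor of [a] and [b] to [a * b]; it is
    additive and multiplicative by construction, so that being an isomorphism
    onto [E] amounts to being injective with image [E]. *)
Definition natural_tensor_iso (E : divringClosed T) : Prop :=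
  injective tensor_mul /\ (forall y, y \in E <-> exists u, tensor_mul u = y).

End Tensor.

Section Roots.
Variable T : closedFieldType.

(** [proot p k x] is the [p ^ k]-th root of [x]; it is unique when [T] has
    characteristic [p]. *)
Definition proot (p k : nat) (x : T) : T :=
  if pselect (exists y, y ^+ (p ^ k) = x) is left exy
  then projT1 (cid exy) else 0.

Lemma prootK p k x : (0 < p)%N -> proot p k x ^+ (p ^ k) = x.
Proof.
move=> p_gt0; rewrite /proot; case: pselect => [exy|]; first by case: cid.
case; have m_gt0 : (0 < p ^ k)%N by rewrite expn_gt0 p_gt0.
have [y] := solve_monicpoly (fun i => if i == 0 then x else 0) m_gt0.
rewrite -(prednK m_gt0) big_ord_recl /= mulr1 big1 ?addr0 => [|i _].
  by exists y.
by rewrite mul0r.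
Qed.

End Roots.

Section Numbers.
Variables (T : closedFieldType) (p : nat).
Implicit Types (F E : divringClosed T).

(** [lam i], for [i <= s], are the coefficients of the separable polynomial
    [fsep] of degree [s]. *)
Section Coefficients.
Variables (s n : nat) (lam : nat -> T).

Definition roots_in (k : nat) F : bool :=
  [forall i : 'I_s, proot p k (lam i) \in F].

Definition m_base F : nat := \max_(m < n.+1 | roots_in m F) m.

Definition m_ext F E : nat :=
  \max_(m < (n - m_base F).+1 | roots_in (m_base F + m) E) m.

Definition root_poly (k : nat) : {poly T} :=
  \poly_(i < s.+1) proot p k (lam i).

Definition adjoin_roots F (k : nat) : divringClosed T :=
  adjoin F (fun y => exists i : 'I_s, y = proot p k (lam i)).

End Coefficients.

Definition is_max (P : nat -> Prop) (m : nat) : Prop :=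
  P m /\ forall m', P m' -> (m' <= m)%N.

Record setting (K : divringClosed T) (theta : T) (f fsep : {poly fld K})
    (n : nat) (N : divringClosed T) : Prop := {
  (* [T] is an algebraic closure of [K], whose characteristic is [p] *)
  setting_char : p \in [pchar fld K];
  setting_closure : forall x : T, algebraicOver (val : fld K -> T) x;
  setting_f_irreducible : irreducible_poly f;
  setting_f_minimal : minimal_polynomial theta f;
  setting_fsep_separable : separable_poly fsep;
  setting_f_presentation : f = fsep \Po 'X^(p ^ n);
  setting_N_ext : {subset K <= N};
  setting_N_pi : purely_insep_ext p K N
}.

Definition sep_degree (K : divringClosed T) (fsep : {poly fld K}) : nat :=
  (size fsep).-1.

Definition sep_coef (K : divringClosed T) (fsep : {poly fld K}) (i : nat) : T :=
  val fsep`_i.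

End Numbers.

(* Main.v *)
From HB Require Import structures.
Require Import Defs.
From mathcomp Require Import all_boot all_order all_algebra separable.
From mathcomp Require Import qpoly boolp zify.

(** Let [F] be purely inseparable over [K] and [j <= n]. A separable element
    generates the same field as its [p]-th power, and a separable extension of
    [K] keeps its degree over [F]. Hence, if [theta ^+ (p ^ (n - j))] is
    separable over [F], then raising the coefficients of its minimal polynomial
    to the power [p ^ j] gives [fsep], so that this polynomial is
    [root_poly j]; conversely, if [root_poly j] has coefficients in [F], then it
    is separable. So the largest [j <= n] such that the [p ^ j]-th roots of the
    coefficients are in [F] is also the largest one such that
    [theta ^+ (p ^ (n - j))] is separable over [F]; that power generates the
    maximal separable subextension [S] of [F(theta) / F], and [theta] has
    degree [p ^ (n - j)] over [S].
    Apply this to [F = N], where [j] is [m1], to [F = NLpi], where [j] is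
    [m1 + m2], and to [F = N(lam_i^(1/p^(m1 + m2)))]: as [theta] has the same
    degree over the last two fields, they coincide. Finally [NLpi] and [NLsep]
    are linearly disjoint over [N], whence [[NLpi : N] = [E : NLsep]]. *)

Set Implicit Arguments.
Unset Strict Implicit.
Unset Printing Implicit Defensive.

Import GRing.Theory.
Local Open Scope ring_scope.

(** * Generated subfields and composita *)

Section Adjunction.
Variable T : fieldType.
Implicit Types (F E S : divringClosed T) (x y : T) (A : T -> Prop).

Lemma adjoin_base F A : {subset F <= adjoin F A}.
Proof. by move=> y Fy; apply/asboolP => S; apply; left. Qed.

Lemma adjoin_gen F A y : A y -> y \in adjoin F A.
Proof. by move=> Ay; apply/asboolP => S; apply; right. Qed.

Lemma adjoin_least F A S :
  {subset F <= S} -> (forall y, A y -> y \in S) -> {subset adjoin F A <= S}.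
Proof. by move=> sFS sAS y /asboolP; apply=> z [/sFS|/sAS]. Qed.

Lemma adjoin1_gen F x : x \in adjoin1 F x.
Proof. exact: adjoin_gen. Qed.

Lemma adjoin1_least F x S :
  {subset F <= S} -> x \in S -> {subset adjoin1 F x <= S}.
Proof. by move=> sFS Sx; apply: adjoin_least => // y ->. Qed.

Lemma compositum_l F E : {subset F <= compositum F E}.
Proof. exact: adjoin_base. Qed.

Lemma compositum_r F E : {subset E <= compositum F E}.
Proof. by move=> y Ey; apply: adjoin_gen. Qed.

Lemma compositum_least F E S :
  {subset F <= S} -> {subset E <= S} -> {subset compositum F E <= S}.
Proof. exact: adjoin_least. Qed.

Lemma ext_degree_eq F E E' d : E =i E' -> ext_degree F E d -> ext_degree F E' d.
Proof.
move=> eE [sFE [b Eb bP]]; split=> [y /sFE|]; first by rewrite eE.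
by exists b => [i|y]; rewrite -eE //; apply: bP.
Qed.

End Adjunction.

(** * Minimal polynomials over a subfield *)

Section MinimalPolynomial.
Variable T : fieldType.
Implicit Types (F E S : divringClosed T) (x y : T) (h P : {poly T}).

(** The polynomial lives over [T], so that one and the same [h] can be minimal over several
    subfields. *)
Definition minp F x h :=
  exists2 g : {poly fld F}, minimal_polynomial x g & map_poly val g = h.

Lemma polyOver_val F (g : {poly fld F}) : map_poly val g \is a polyOver F.
Proof. by apply/polyOverP => i; rewrite coef_map; apply: fld_valP. Qed.

Lemma polyOver_lift F h :
  h \is a polyOver F -> exists g : {poly fld F}, map_poly val g = h.
Proof.
move=> /polyOverP Fh.
exists (\poly_(i < size h) Fld (Fh i)); apply/polyP => i.
rewrite coef_map coef_poly /=; case: ltnP => // sh.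
by rewrite nth_default.
Qed.

Lemma polyOver_sub F E h :
  {subset F <= E} -> h \is a polyOver F -> h \is a polyOver E.
Proof. by move=> sFE /polyOverP Fh; apply/polyOverP => i; apply: sFE. Qed.

Section Properties.
Variables (F : divringClosed T) (x : T) (h : {poly T}).
Hypothesis hx : minp F x h.

Lemma minp_over : h \is a polyOver F.
Proof. by case: hx => g _ <-; apply: polyOver_val. Qed.

Lemma minp_monic : h \is monic.
Proof. by case: hx => g [mg _ _] <-; rewrite map_monic. Qed.

Lemma minp_root : root h x.
Proof. by case: hx => g [_ rg _] <-. Qed.

Lemma minp_neq0 : h != 0.
Proof. exact: monic_neq0 minp_monic. Qed.

Lemma minp_size_gt1 : (1 < size h)%N.
Proof. exact: root_size_gt1 minp_neq0 minp_root. Qed.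

Lemma minp_dvd P : P \is a polyOver F -> root P x -> h %| P.
Proof.
case: hx => g [_ _ dg] <- /polyOver_lift[P' <-] rP.
by rewrite dvdp_map; apply: dg.
Qed.

Lemma minp_size P :
  P \is a polyOver F -> root P x -> P != 0 -> (size h <= size P)%N.
Proof. by move=> FP rP nzP; apply: dvdp_leq => //; apply: minp_dvd. Qed.

Lemma minp_eq P :
  P \is a polyOver F -> P \is monic -> root P x -> (size P <= size h)%N -> P = h.
Proof.
move=> FP mP rP sP; apply/esym/eqP; rewrite -eqp_monic ?minp_monic //.
by rewrite -dvdp_size_eqp ?minp_dvd // eqn_leq sP minp_size ?monic_neq0.
Qed.

Lemma minp_small P :
  P \is a polyOver F -> root P x -> (size P < size h)%N -> P = 0.
Proof. by move=> FP rP; apply: contraTeq => nzP; rewrite -leqNgt minp_size. Qed.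

End Properties.

(** The remainder of a division by [h] vanishes at [x] and is too small to be nonzero. *)
Lemma minp_intro F x h :
    h \is a polyOver F -> h \is monic -> root h x ->
    (forall P, P \is a polyOver F -> root P x -> P != 0 -> (size h <= size P)%N) ->
  minp F x h.
Proof.
move=> /polyOver_lift[g <-] mg rg min_g; exists g => //.
have{}mg : g \is monic by move: mg; rewrite map_monic.
split=> // P rP; apply/modp_eq0P/eqP; apply: contraTT isT => nz.
have rr : root (map_poly val (P %% g)) x.
  rewrite map_modp rootE.
  have := divp_eq (map_poly val P) (map_poly val g).
  move=> /(congr1 (horner^~ x)); rewrite hornerD hornerM.
  by rewrite (eqP rP) (eqP rg) mulr0 add0r => <-.
have := min_g _ (polyOver_val _) rr; rewrite map_poly_eq0 => /(_ nz).
by rewrite !size_map_poly leqNgt ltn_modp monic_neq0.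
Qed.

Lemma minp_exists F x h :
  h \is a polyOver F -> h != 0 -> root h x -> exists g, minp F x g.
Proof.
move=> /polyOver_lift[g <-]; rewrite map_poly_eq0 => nzg rg.
by have [g' mg'] := min_polyP nzg rg; exists (map_poly val g'); exists g'.
Qed.

(** In a factorization of [g], one factor vanishes at [x]; minimality makes [g] divide it, and
    comparing sizes leaves the other factor constant. *)
Lemma minp_irreducible F x (g : {poly fld F}) :
  minimal_polynomial x g -> irreducible_poly g.
Proof.
move=> [mg rg dg]; have nzg := monic_neq0 mg; split=> [|q sq dqg].
  rewrite -(size_map_poly (val : fld F -> T)).
  by apply: root_size_gt1 rg; rewrite map_poly_eq0.
have nzq : q != 0 by apply: contraNneq nzg => q0; rewrite q0 dvd0p in dqg.
rewrite /eqp dqg dg //.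
have := divpK dqg => /(congr1 (map_poly (val : fld F -> T))).
rewrite rmorphM => eg; move: (rg); rewrite -eg rootM => /orP[/dg|//] dqq.
case/eqP: sq; apply/eqP; rewrite eqn_leq size_poly_gt0 nzq andbT.
have nzd : g %/ q != 0 by rewrite divp_eq0 negb_or nzg negb_or nzq -leqNgt dvdp_leq.
have := dvdp_leq nzd dqq; rewrite size_divp //.
have: (0 < size q)%N by rewrite size_poly_gt0.
have : (0 < size g)%N by rewrite size_poly_gt0.
by case: (size q) (size g) => // -[|a] [|b] //= _ _; rewrite subSS ltnNge leq_subr.
Qed.

(** The values at [x] of polynomials over [F] already form a field: the irreducible [g] is coprime
    to every polynomial that does not vanish at [x], and a Bezout relation evaluated at [x] gives
    the inverse. Reduction modulo [g] then bounds the size. *)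
Lemma adjoin1P F x h y : minp F x h ->
  y \in adjoin1 F x <->
  exists P, [/\ P \is a polyOver F, (size P < size h)%N & y = P.[x]].
Proof.
move=> hx; have [g mgx eg] := hx; have [mg rg dg] := mgx.
have nzg := monic_neq0 mg; have sh : size h = size g by rewrite -eg size_map_poly.
pose S : pred T := fun y => `[< exists P : {poly fld F}, y = (map_poly val P).[x] >].
have SP z : reflect (exists P : {poly fld F}, z = (map_poly val P).[x]) (z \in S).
  exact: asboolP.
have clS : divring_closed S.
  split=> [|a b /SP[P ->] /SP[Q ->]|a b /SP[P ->] /SP[Q ->]]; apply/SP.
  - by exists 1; rewrite rmorph1 hornerC.
  - by exists (P - Q); rewrite rmorphB hornerD hornerN.
  (* A quotient by [0] is [0] by convention, so this case is harmless. *)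
  have [Q0|nzQ] := eqVneq (map_poly val Q).[x] 0.
    by exists 0; rewrite Q0 invr0 mulr0 rmorph0 horner0.
  have cgQ : coprimep g Q.
    rewrite (irreducible_poly_coprime _ (minp_irreducible mgx)).
    apply: contra nzQ => /divpK eQ; rewrite -{}eQ rmorphM /= hornerM.
    by rewrite (eqP rg) mulr0.
  have /Bezout_eq1_coprimepP[[u v] /= uv] := cgQ.
  exists (P * v); rewrite (rmorphM (map_poly (val : fld F -> T))) hornerM.
  congr (_ * _).
  have := congr1 (fun q => (map_poly (val : fld F -> T) q).[x]) uv.
  rewrite rmorphD !rmorphM hornerD !hornerM (eqP rg) mulr0 add0r rmorph1 hornerC.
  by move=> e; apply: (mulIf nzQ); rewrite mulVf.
pose mS := GRing.isDivringClosed.Build T S clS.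
pose M : divringClosed T := HB.pack S mS.
split=> [|[P [/polyOverP FP _ ->]]]; last first.
  rewrite horner_coef; apply: rpred_sum => i _.
  by rewrite rpredM ?rpredX ?adjoin1_gen ?adjoin_base.
move=> Fxy; have : y \in M.
  apply: adjoin1_least Fxy => [z Fz|]; apply/SP.
    by exists (Fld Fz)%:P; rewrite map_polyC hornerC.
  by exists 'X; rewrite map_polyX hornerX.
move=> /SP[P ->]; exists (map_poly val (P %% g)); split; first exact: polyOver_val.
  by rewrite sh size_map_poly ltn_modp.
rewrite {1}(divp_eq P g) rmorphD rmorphM hornerD hornerM.
by rewrite (eqP rg) mulr0 add0r.
Qed.

End MinimalPolynomial.

(** * Free and spanning families, degrees *)

Section Degree.
Variable T : fieldType.
Implicit Types (F E : divringClosed T) (x y : T) (h : {poly T}).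

Definition free_over F d (b : 'I_d -> T) :=
  forall c : 'I_d -> fld F, \sum_i val (c i) * b i = 0 -> forall i, c i = 0.

Definition spans F d (b : 'I_d -> T) y :=
  exists c : 'I_d -> fld F, y = \sum_i val (c i) * b i.

(** Uniqueness of coordinates amounts to freeness: compare two expressions of [0], or subtract two
    expressions of [y]. *)
Lemma ext_degreeP F E d : ext_degree F E d <->
  {subset F <= E} /\ exists b : 'I_d -> T,
    [/\ forall i, b i \in E, free_over F b & {in E, forall y, spans F b y}].
Proof.
split=> [[sFE [b Eb bP]]|[sFE [b [Eb fb sb]]]].
  split=> //; exists b; split=> // [c c0 i|y /bP[c [-> _]]]; last by exists c.
  have [c' [_ uc']] := bP 0 (rpred0 _).
  pose z : {ffun 'I_d -> fld F} := [ffun=> 0]; pose fc := [ffun i => c i].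
  have /uc' ez : 0 = \sum_i val (z i) * b i.
    by rewrite big1 // => j _; rewrite ffunE mul0r.
  have /uc' ec : 0 = \sum_i val (fc i) * b i.
    by rewrite -[LHS]c0; apply: eq_bigr => j _; rewrite ffunE.
  have := congr1 (fun g : {ffun 'I_d -> fld F} => g i) (etrans (esym ec) ez).
  by rewrite !ffunE.
split=> //; exists b => // y /sb[c ->]; exists [ffun i => c i]; split.
  by apply: eq_bigr => i _; rewrite ffunE.
move=> c' /esym e; apply/ffunP => i; rewrite ffunE; apply/esym/subr0_eq.
apply: (fb (fun i => c' i - c i)).
transitivity (\sum_i val (c' i) * b i - \sum_i val (c i) * b i).
  by rewrite -sumrB; apply: eq_bigr => j _; rewrite rmorphB mulrBl.
by rewrite e subrr.
Qed.

(** The coordinates of [b] along [b'] form a matrix, which has more rows than columns if [d' < d]; a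
    nonzero vector of its left kernel is then a relation between the [b i]. *)
Lemma free_leq_span F d d' (b : 'I_d -> T) (b' : 'I_d' -> T) :
  free_over F b -> (forall i, spans F b' (b i)) -> (d <= d')%N.
Proof.
move=> fb /choice[A bA]; pose M : 'M[fld F]_(d, d') := \matrix_(i, j) A i j.
rewrite leqNgt; apply/negP => lt_d.
have : kermx M != 0.
  by rewrite kermx_eq0 /row_free neq_ltn (leq_ltn_trans (rank_leq_col M)).
case/rowV0Pn => v /sub_kermxP vM /eqP; apply; apply/rowP => i; rewrite mxE.
apply: (fb (v 0)).
under eq_bigr => k _ do rewrite [b k]bA mulr_sumr.
rewrite exchange_big big1 //= => j _.
have /(congr1 val) := congr1 (fun u : 'rV_d' => u 0 j) vM.
rewrite !mxE rmorph_sum /= => vM0.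
under eq_bigr => k _ do rewrite mulrA.
rewrite -mulr_suml [X in X * _](_ : _ = 0) ?mul0r // -[RHS]vM0.
by apply: eq_bigr => k _; rewrite !mxE.
Qed.

Lemma ext_degree_uniq F E d d' : ext_degree F E d -> ext_degree F E d' -> d = d'.
Proof.
move=> /ext_degreeP[_ [b [Eb fb sb]]] /ext_degreeP[_ [b' [Eb' fb' sb']]].
apply/eqP; rewrite eqn_leq (free_leq_span fb (fun i => sb' _ (Eb i))).
exact: free_leq_span fb' (fun i => sb _ (Eb' i)).
Qed.

Section Powers.
Variables (F : divringClosed T) (x : T) (h : {poly T}) (d : nat).
Hypotheses (hx : minp F x h) (sh : size h = d.+1).

Lemma minp_free : free_over F (fun i : 'I_d => x ^+ i).
Proof.
move=> c c0 i; apply: val_inj.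
(* The relation becomes a polynomial vanishing at [x]. Here [insub] only turns [j < d] into an
   ordinal; its default is never read. *)
pose P := \poly_(j < d) (if insub j is Some k then val (c k) else 0).
have Pi (j : 'I_d) : P`_j = val (c j) by rewrite coef_poly ltn_ord valK.
suff P0 : P = 0 by rewrite /= -Pi P0 coef0.
apply: (minp_small hx); last by rewrite sh ltnS size_poly.
  apply/polyOverP => j; rewrite coef_poly; case: ltnP => [ltj|_]; last exact: rpred0.
  by rewrite insubT; apply: fld_valP.
rewrite /root (horner_coef_wide _ (size_poly _ _)) -[X in _ == X]c0.
by apply/eqP/eq_bigr => j _; rewrite Pi.
Qed.

Lemma minp_span y : y \in adjoin1 F x -> spans F (fun i : 'I_d => x ^+ i) y.
Proof.
move=> /(adjoin1P y hx)[P [/polyOverP FP]]; rewrite sh ltnS => sP ->.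
exists (fun i => Fld (FP i)).
by rewrite (horner_coef_wide _ sP); apply: eq_bigr.
Qed.

Lemma minp_degree : ext_degree F (adjoin1 F x) d.
Proof.
apply/ext_degreeP; split; first exact: adjoin_base.
exists (fun i : 'I_d => x ^+ i); split; last exact: minp_span.
  by move=> i; rewrite rpredX ?adjoin1_gen.
exact: minp_free.
Qed.

End Powers.

(* Modulo the minimal polynomial of [x] over [F], an element of [E] is a
   polynomial of low degree in [x], which must be constant over [E]. *)
Lemma minp_sub F E x g h :
    {subset F <= E} -> {subset E <= adjoin1 F x} -> minp E x g ->
    h \is a polyOver F -> root h x -> h != 0 -> (size h <= size g)%N ->
  {subset E <= F}.
Proof.
move=> sFE sEF gx Fh rh nzh shg y Ey.
have [h' hx'] := minp_exists Fh nzh rh.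
have [P [FP sP eP]] := (adjoin1P y hx').1 (sEF y Ey).
have sg := minp_size_gt1 gx.
have sPg : (size P < size g)%N.
  exact: leq_trans sP (leq_trans (minp_size hx' Fh rh nzh) shg).
have := minp_small gx (P := P - y%:P).
rewrite /root hornerD hornerN hornerC -eP subrr eqxx => /(_ _ isT).
rewrite (rpredB (polyOver_sub sFE FP)) ?polyOverC // => /(_ isT).
rewrite (leq_ltn_trans (size_polyD _ _)) ?gtn_max ?sPg ?size_polyN; last first.
  by rewrite size_polyC (leq_ltn_trans (leq_b1 _)).
move=> /(_ isT)/eqP; rewrite subr_eq0 => /eqP ePy.
by move/polyOverP/(_ 0%N): FP; rewrite ePy coefC.
Qed.

End Degree.

(** * Separable elements *)

Section Separable.
Variable T : fieldType.
Implicit Types (F E S : divringClosed T) (x y : T) (h P : {poly T}).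

Lemma separable_over_minp F x :
  separable_over F x <-> exists2 h, minp F x h & separable_poly h.
Proof.
split=> [[g mg sg]|[h [g mg <-] sg]].
  by exists (map_poly val g); [exists g | rewrite separable_map].
by exists g => //; move: sg; rewrite separable_map.
Qed.

Lemma separable_over_root F x h :
  h \is a polyOver F -> separable_poly h -> root h x -> separable_over F x.
Proof.
move=> /polyOver_lift[g <-]; rewrite separable_map => sg rg.
exact: sep_overP sg rg.
Qed.

Lemma separable_over_sub F E x :
  {subset F <= E} -> separable_over F x -> separable_over E x.
Proof.
move=> sFE /separable_over_minp[h hx sh].
apply: separable_over_root sh (minp_root hx).
exact: polyOver_sub sFE (minp_over hx).
Qed.

(** By [sep_closed] the separable elements form a subfield, which contains [F] and [x]. *)
Lemma separable_adjoin1 F x : separable_over F x -> separable_ext F (adjoin1 F x).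
Proof.
move=> sx; pose S : pred T := fun y => `[< separable_over F y >].
have SP y : reflect (separable_over F y) (y \in S) by apply: asboolP.
have clS : divring_closed S.
  split=> [|a b /SP sa /SP sb|a b /SP sa /SP sb]; apply/SP.
  - exact: sep_over_base (rpred1 _).
  - by case: (sep_closed sa sb).
  - by case: (sep_closed sa sb).
pose mS := GRing.isDivringClosed.Build T S clS.
pose M : divringClosed T := HB.pack S mS.
move=> y Fxy; apply/SP; rewrite -[_ \in S]/(y \in M).
by apply: adjoin1_least Fxy => [z Fz|]; apply/SP => //; apply: sep_over_base.
Qed.

(** From right to left, maximality is applied to [F(y)], which is separable over [F]. *)
Lemma mem_max_sep F E y : {subset F <= E} ->
  y \in max_sep F E <-> y \in E /\ separable_over F y.
Proof.
move=> sFE; have [sFM sME sepM maxM] := max_sepP sFE.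
split=> [My|[Ey sy]]; first by split; [apply: sME | apply: sepM].
apply: (maxM (adjoin1 F y)); [exact: adjoin_base | | | exact: adjoin1_gen].
  by apply: adjoin1_least.
exact: separable_adjoin1.
Qed.

End Separable.

(** * Frobenius powers and purely inseparable elements *)

Section Frobenius.
Variables (T : fieldType) (p : nat) (pT : p \in [pchar T]).
Implicit Types (F E S : divringClosed T) (x y : T) (h P : {poly T}).

Let p_pr : prime p := pcharf_prime pT.

Lemma pchar_pnat k : [pchar T].-nat (p ^ k)%N.
Proof. by rewrite pnatX pnatE // pT. Qed.

(** The proof that [p] is the characteristic is an argument, so that the morphism structures
    declared below, which depend on it, can be inferred from the term. *)
Definition frob (_ : p \in [pchar T]) (k : nat) (x : T) : T := x ^+ (p ^ k).

Lemma frob_is_zmod_morphism k : zmod_morphism (frob pT k).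
Proof.
move=> x y; rewrite /frob exprDn_pchar ?exprNn_pchar //; exact: pchar_pnat.
Qed.

Lemma frob_is_monoid_morphism k : monoid_morphism (frob pT k).
Proof. by split=> [|x y]; rewrite /frob ?expr1n ?exprMn. Qed.

HB.instance Definition _ k :=
  GRing.isZmodMorphism.Build T T (frob pT k) (frob_is_zmod_morphism k).
HB.instance Definition _ k :=
  GRing.isMonoidMorphism.Build T T (frob pT k) (frob_is_monoid_morphism k).

Lemma frobE k x : frob pT k x = x ^+ (p ^ k).
Proof. by []. Qed.

Lemma frob_inj k : injective (frob pT k).
Proof. exact: fmorph_inj. Qed.

Lemma expr_pD x j k : x ^+ (p ^ (j + k)) = (x ^+ (p ^ j)) ^+ (p ^ k).
Proof. by rewrite expnD exprM. Qed.

(** The preimage of [S] under a Frobenius power is a subfield, so it is enough to look at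
    generators. *)
Lemma frob_adjoin F S (A : T -> Prop) k :
    {in F, forall y, y ^+ (p ^ k) \in S} -> (forall y, A y -> y ^+ (p ^ k) \in S) ->
  {in adjoin F A, forall y, y ^+ (p ^ k) \in S}.
Proof.
move=> FS AS; pose R : pred T := fun y => frob pT k y \in S.
have RE y : (y \in R) = (frob pT k y \in S) by [].
have clR : divring_closed R.
  split=> [|a b|a b]; rewrite !RE ?rmorph1 ?rmorphB ?fmorph_div.
  - exact: rpred1.
  - exact: rpredB.
  - exact: rpred_div.
pose mR := GRing.isDivringClosed.Build T R clR.
pose M : divringClosed T := HB.pack R mR.
by move=> y; apply: (@adjoin_least _ _ _ M).
Qed.

Lemma mem_max_pi F E y : {subset F <= E} ->
  y \in max_pi p F E <-> y \in E /\ exists k, y ^+ (p ^ k) \in F.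
Proof.
move=> sFE; have [sFM sME piM maxM] := max_piP pT sFE.
split=> [My|[Ey [k Fy]]]; first by split; [apply: sME | apply: piM].
apply: (maxM (adjoin1 F y)); [exact: adjoin_base | | | exact: adjoin1_gen].
  by apply: adjoin1_least.
(* The exponent of [y] serves for all elements of [F(y)]. *)
move=> z Fyz; exists k; apply: frob_adjoin Fyz => [t|t ->] //.
by move=> Ft; rewrite rpredX.
Qed.

Lemma frob_XsubC x k : ('X - x%:P) ^+ (p ^ k) = 'X^(p ^ k) - (x ^+ (p ^ k))%:P.
Proof.
have pn : [pchar {poly T}].-nat (p ^ k)%N.
  by rewrite pnatX pnatE // pchar_poly pT.
by rewrite exprDn_pchar // exprNn_pchar // polyC_exp.
Qed.

Lemma XsubC_over F x k :
  x ^+ (p ^ k) \in F -> ('X^(p ^ k) - (x ^+ (p ^ k))%:P) \is a polyOver F.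
Proof. by move=> Fx; rewrite rpredB ?polyOverXn ?polyOverC. Qed.

Lemma root_XnsubC x m : root ('X^m - (x ^+ m)%:P) x.
Proof. by rewrite rootE hornerD hornerN hornerXn hornerC subrr. Qed.

(** By Frobenius, ['X^(p ^ k) - x ^+ (p ^ k)] is a power of ['X - x], and its monic divisors are the
    smaller powers. *)
Lemma minp_pi F x k g : x ^+ (p ^ k) \in F -> minp F x g ->
  exists2 m, (0 < m <= p ^ k)%N & g = ('X - x%:P) ^+ m.
Proof.
move=> Fx gx; have := minp_dvd gx (XsubC_over Fx) (root_XnsubC _ _).
rewrite -frob_XsubC => /dvdp_exp_XsubCP[m le_m eg].
have {}eg : g = ('X - x%:P) ^+ m.
  by apply/eqP; rewrite -eqp_monic ?(minp_monic gx) ?monic_exp ?monicXsubC.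
exists m => //; rewrite le_m andbT lt0n; apply/eqP => m0.
by have := minp_size_gt1 gx; rewrite eg m0 expr0 size_poly1.
Qed.

(** The minimal polynomial is both a power of ['X - x] and squarefree, hence is ['X - x] itself. *)
Lemma separable_pi_mem F x k :
  separable_over F x -> x ^+ (p ^ k) \in F -> x \in F.
Proof.
move=> /separable_over_minp[g gx sg] Fx.
have [m /andP[m_gt0 _] eg] := minp_pi Fx gx.
have m1 : m = 1%N.
  apply/eqP; rewrite eqn_leq m_gt0 andbT leqNgt; apply/negP => m_gt1.
  by have := separable_nosquare sg m_gt1 (u := 'X - x%:P);
     rewrite eg size_XsubC dvdpp => /(_ isT).
have /polyOverP/(_ 0%N) := minp_over gx.
by rewrite eg m1 expr1 coefB coefX coefC sub0r rpredN.
Qed.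

(* The constant coefficient shows that [x ^+ m] is in [F], where [m] is the
   degree of [x]; hence so is [x ^+ gcdn m (p ^ k)], which forces
   [p ^ k %| m]. *)
Lemma minp_pure_insep F x k :
    x ^+ (p ^ k) \in F -> (forall e, x ^+ (p ^ e) \in F -> (k <= e)%N) ->
  minp F x ('X^(p ^ k) - (x ^+ (p ^ k))%:P).
Proof.
move=> Fx min_k; have q_gt0 : (0 < p ^ k)%N by rewrite expn_gt0 prime_gt0.
have [g gx] : exists g, minp F x g.
  apply: minp_exists (XsubC_over Fx) _ (root_XnsubC _ _).
  by rewrite -frob_XsubC expf_neq0 ?polyXsubC_eq0.
have [m /andP[m_gt0 le_m] eg] := minp_pi Fx gx.
have Fxm : x ^+ m \in F.
  have := rpred_horner (minp_over gx) (rpred0 F).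
  by rewrite eg horner_exp hornerXsubC sub0r exprNn rpredMsign.
have Fgcd : x ^+ gcdn m (p ^ k) \in F.
  have [->|nzx] := eqVneq x 0.
    by rewrite expr0n gtn_eqF ?rpred0 // gcdn_gt0 m_gt0.
  (* Bezout in the exponents: [u * m = v * p ^ k + gcdn m (p ^ k)]. The subtraction becomes a
     division, whence the separate case [x = 0]. *)
  case: (egcdnP (p ^ k) m_gt0) => u v e _.
  rewrite -(mulfK (expf_neq0 (v * p ^ k)%N nzx) (x ^+ gcdn _ _)) -exprD addnC -e.
  by rewrite rpred_div // mulnC exprM rpredX.
have [e le_e Ege] : exists2 e, (e <= k)%N & gcdn m (p ^ k) = (p ^ e)%N.
  by apply/(dvdn_pfactor _ _ p_pr); apply: dvdn_gcdr.
have ek : e = k by apply/eqP; rewrite eqn_leq le_e min_k // -Ege.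
have mq : m = (p ^ k)%N.
  apply/eqP; rewrite eqn_leq le_m dvdn_leq //.
  by rewrite -{1}ek -Ege dvdn_gcdl.
by rewrite -frob_XsubC -mq -eg.
Qed.

Lemma map_frob_over F h k :
  h \is a polyOver F -> map_poly (frob pT k) h \is a polyOver F.
Proof.
by move=> /polyOverP Fh; apply/polyOverP => i; rewrite coef_map /= rpredX.
Qed.

Lemma root_map_frob h x k : root h x -> root (map_poly (frob pT k) h) (x ^+ (p ^ k)).
Proof. by rewrite -frobE fmorph_root. Qed.

(** Over [F(x ^+ (p ^ k))] the element [x] is both separable and purely inseparable, hence it lies
    in that field. *)
Lemma adjoin1_pexp F x k :
  separable_over F x -> adjoin1 F (x ^+ (p ^ k)) =i adjoin1 F x.
Proof.
move=> sx y; apply/idP/idP; apply: adjoin1_least => [|//]; try exact: adjoin_base.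
  by rewrite rpredX ?adjoin1_gen.
apply: (separable_pi_mem (k := k)); last exact: adjoin1_gen.
exact: separable_over_sub (@adjoin_base _ _ _) sx.
Qed.

Lemma minp_size_pexp F x k g h :
    separable_over F x -> minp F x g -> minp F (x ^+ (p ^ k)) h ->
  size h = size g.
Proof.
move=> sx gx hx; have gg := minp_size_gt1 gx; have hh := minp_size_gt1 hx.
rewrite -(prednK (ltnW gg)) -(prednK (ltnW hh)); congr _.+1.
apply: ext_degree_uniq (minp_degree gx _); last by rewrite prednK // ltnW.
apply: ext_degree_eq (adjoin1_pexp k sx) _.
by apply: (minp_degree hx _); rewrite prednK // ltnW.
Qed.

End Frobenius.

(** * Simple extensions as quotients of polynomial rings *)

Section Presentation.
Variable T : fieldType.
Implicit Types (F E : divringClosed T) (x y : T) (h : {poly T}).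

(** The isomorphism is evaluation at [x]: injective because a class has a representative smaller
    than the minimal polynomial, surjective by [adjoin1P]. *)
Lemma quotient_iso_minp F E x (g : {poly fld F}) :
  minimal_polynomial x g -> E =i adjoin1 F x -> quotient_iso g E x.
Proof.
move=> mgx eE; have [mg rg dg] := mgx; have [sg _] := minp_irreducible mgx.
have gx : minp F x (map_poly val g) by exists g.
(* The quotient ring is formed with [mk_monic g], which replaces [g] by a default unless it is monic
   and nonconstant. *)
have gE : mk_monic g = g by rewrite /mk_monic sg mg.
pose ev (q : {poly fld F}) : T := (map_poly val q).[x].
have ev_mod q : ev (Pdiv.CommonRing.rmodp q (mk_monic g)) = ev q.
  rewrite gE -Pdiv.IdomainMonic.modpE // /ev {2}(divp_eq q g).
  by rewrite rmorphD rmorphM hornerD hornerM (eqP rg) mulr0 add0r.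
have Eev q : ev q \in E.
  rewrite eE /ev horner_coef; apply: rpred_sum => i _.
  by rewrite coef_map rpredM ?rpredX ?adjoin1_gen ?adjoin_base ?fld_valP.
pose phi (q : {poly %/ g}) : fld E := Fld (Eev (q : {poly fld F})).
have phi_zmod : zmod_morphism phi.
  move=> a b; apply: val_inj; rewrite /= /ev -hornerN -hornerD -rmorphB.
  by [].
have phi_monoid : monoid_morphism phi.
  split=> [|a b]; apply: val_inj.
    by rewrite /= /ev map_polyC hornerC.
  by rewrite /= ev_mod /ev (rmorphM (map_poly (val : fld F -> T))) hornerM.
pose mA := GRing.isZmodMorphism.Build _ _ phi phi_zmod.
pose mM := GRing.isMonoidMorphism.Build _ _ phi phi_monoid.
pose phiM : {rmorphism {poly %/ g} -> fld E} := HB.pack phi mA mM.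
exists phiM; split.
- have phi_inj : injective phi.
    move=> a b /(congr1 val) /= eab; apply/eqP; rewrite -subr_eq0; apply/eqP.
    apply: val_inj => /=; apply/eqP; rewrite -(map_poly_eq0 (val : fld F -> T)).
    apply/eqP/(minp_small gx); first exact: polyOver_val.
      by rewrite rootE rmorphB hornerD hornerN subr_eq0; apply/eqP/eab.
    rewrite !size_map_poly -[X in (_ < X)%N](congr1 (@size _) (congr1 polyseq gE)).
    exact: (size_mk_monic (a - b)).
  have phi_surj (y : fld E) : exists q, phi q = y.
    have := fld_valP y; rewrite eE => /(adjoin1P _ gx)[P [/polyOver_lift[q eq] sq ey]].
    exists (in_qpoly g q); apply: val_inj => /=.
    by rewrite ev_mod /ev eq.
  have [psi psiK] := choice phi_surj; exists psi => // a.
  by apply: phi_inj; rewrite psiK.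
- by move=> c; rewrite /= /ev map_polyC hornerC.
- by rewrite /= ev_mod /ev map_polyX hornerX.
Qed.

Lemma presented_by_minp F E x h :
  minp F x h -> E =i adjoin1 F x -> presented_by F h x E.
Proof.
move=> [g mgx <-] eE; exists g; have [mg _ _] := mgx; split=> //.
  exact: minp_irreducible mgx.
exact: quotient_iso_minp.
Qed.

End Presentation.

(** * Linear disjointness of [M] and [F(x)] over [F], when [x] has the same minimal polynomial over
    both [F] and [M] *)

Section LinearDisjointness.
Local Open Scope quotient_scope.
Variables (T : fieldType) (F M S E : divringClosed T) (x : T) (h : {poly T}).
Variable s : nat.
Hypotheses (sFM : {subset F <= M}) (Fx : minp F x h) (Mx : minp M x h).
Hypotheses (sh : size h = s.+1) (eS : S =i adjoin1 F x) (eE : E =i adjoin1 M x).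

Let sFS : {subset F <= S}.
Proof. by move=> y Fy; rewrite eS adjoin_base. Qed.

Let Sx : x \in S.
Proof. by rewrite eS adjoin1_gen. Qed.

Let sME : {subset M <= E}.
Proof. by move=> y My; rewrite eE adjoin_base. Qed.

Let sSE : {subset S <= E}.
Proof.
move=> y; rewrite eS; apply: adjoin1_least => [z /sFM/sME//|].
by rewrite eE adjoin1_gen.
Qed.

(** Expand the coefficients along the powers of [x] and exchange the sums: as these powers are free
    over [M], a relation over [S] splits into [s] relations over [F]. *)
Lemma free_over_disjoint k (b : 'I_k -> T) :
  (forall i, b i \in M) -> free_over F b -> free_over S b.
Proof.
move=> Mb fb c c0.
have cE i : exists n : 'I_s -> fld F, val (c i) = \sum_j val (n j) * x ^+ j.
  have := fld_valP (c i); rewrite eS.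
  exact: (minp_span Fx sh).
have [n cn] := choice cE.
have Ma j : \sum_i val (n i j) * b i \in M.
  by apply: rpred_sum => i _; rewrite rpredM // sFM // fld_valP.
have /(minp_free Mx sh) n0 : \sum_(j < s) val (Fld (Ma j)) * x ^+ j = 0.
  rewrite -[RHS]c0; under [RHS]eq_bigr => i _ do rewrite cn mulr_suml.
  rewrite exchange_big; apply: eq_bigr => j _; rewrite /= mulr_suml.
  by apply: eq_bigr => i _; rewrite mulrAC.
move=> i; apply: val_inj; rewrite cn big1 // => j _.
rewrite (fb (n^~ j)) ?mul0r //.
by have /(congr1 val) := n0 j.
Qed.

(** The same exchange of sums, started from the coordinates over [M] along the powers of [x]. *)
Lemma spans_disjoint k (b : 'I_k -> T) :
  {in M, forall y, spans F b y} -> {in E, forall y, spans S b y}.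
Proof.
move=> sb y; rewrite eE => /(minp_span Mx sh)[a ->].
have aE j : exists n : 'I_k -> fld F, val (a j) = \sum_i val (n i) * b i.
  exact: sb (fld_valP _).
have [n an] := choice aE.
have Sc i : \sum_(j < s) val (n j i) * x ^+ j \in S.
  by apply: rpred_sum => j _; rewrite rpredM ?rpredX // sFS // fld_valP.
exists (fun i => Fld (Sc i)); under eq_bigr => j _ do rewrite an mulr_suml.
rewrite exchange_big; apply: eq_bigr => i _; rewrite /= mulr_suml.
by apply: eq_bigr => j _; rewrite mulrAC.
Qed.

Lemma maximal_free_spans k (b : 'I_k -> T) : free_over F b ->
    (forall b' : 'I_k.+1 -> T, (forall i, b' i \in M) -> ~ free_over F b') ->
    (forall i, b i \in M) ->
  {in M, forall y, spans F b y}.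
Proof.
move=> fb max_k Mb y My; apply: contrapT => nsp.
pose b' (i : 'I_k.+1) := oapp b y (unlift ord_max i).
have b'w i : b' (widen_ord (leqnSn k) i) = b i.
  rewrite /b' (_ : widen_ord _ i = lift ord_max i) ?liftK //.
  by apply: val_inj; rewrite /= /bump leqNgt ltn_ord.
have b'm : b' ord_max = y by rewrite /b' unlift_none.
apply: (max_k b') => [i|c].
  by rewrite /b'; case: (unlift _ i) => [j|] /=.
rewrite big_ord_recr /= b'm; under eq_bigr => i _ do rewrite b'w.
move=> c0.
(* A nonzero last coefficient could be divided out, which would put [y] in the span of [b]. *)
have cm : c ord_max = 0.
  apply: contrapT => /eqP nzc; apply: nsp.
  exists (fun i => - c (widen_ord (leqnSn k) i) / c ord_max).
  have nzv : val (c ord_max) != 0 by rewrite fmorph_eq0.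
  apply: (mulfI nzv); rewrite mulr_sumr.
  move/eqP: c0; rewrite addrC addr_eq0 => /eqP ->; rewrite -sumrN.
  apply: eq_bigr => i _; rewrite fmorph_div rmorphN /=.
  by rewrite mulrA mulrCA mulfV // mulr1 mulNr.
move: c0; rewrite cm mul0r addr0 => /fb c0 i.
case: (unliftP ord_max i) => [j ->|-> //].
by rewrite -[RHS](c0 j); congr c; apply: val_inj; rewrite /= /bump leqNgt ltn_ord.
Qed.

(* The number of elements of a maximal [F]-free family in [M] is at most
   [d], since such a family is also [S]-free. *)
Lemma disjoint_degree d : ext_degree S E d -> ext_degree F M d.
Proof.
move=> dSE; have /ext_degreeP[_ [e [Ee fe se]]] := dSE.
pose P k := `[< exists b : 'I_k -> T, (forall i, b i \in M) /\ free_over F b >].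
have exP : exists k, P k.
  by exists 0%N; apply/asboolP; exists (fun=> 0); split=> [[]|c _ []].
have leP k : P k -> (k <= d)%N.
  case/asboolP => b [Mb /(free_over_disjoint Mb) fb].
  by apply: (free_leq_span fb) => i; apply/se/sME.
case: (ex_maxnP exP leP) => k /asboolP[b [Mb fb]] max_k.
have sb : {in M, forall y, spans F b y}.
  apply: maximal_free_spans => // b' Mb' fb'.
  by have := max_k k.+1; rewrite ltnn => /(_ _)/negP; apply=> //; apply/asboolP; exists b'.
(* The family [b] is a basis of [M] over [F] and also one of [E] over [S], so uniqueness of the
   degree concludes. *)
suff -> : d = k by apply/ext_degreeP; split=> //; exists b.
apply: ext_degree_uniq dSE _; apply/ext_degreeP; split=> //; exists b; split.
- by move=> i; apply: sME.
- exact: free_over_disjoint.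
- exact: spans_disjoint.
Qed.

Let xpow (j : nat) : fld S := Fld (rpredX j Sx).

(** The normal form of a tensor: a combination of the powers of [x] on the right, with coefficients
    from [M] on the left. *)
Let standard (a : nat -> fld M) r : seq (fld M * fld S) :=
  [seq (a j, xpow j) | j <- r].

Local Notation teq := (@tens_eq T F M S).

(** The congruence kills a zero on the left only; the scalar [0] carries it across. *)
Let tens_zeror a : teq [:: (a, 0)] [::].
Proof.
apply: (@tens_trans _ _ _ _ _ [:: (0, 0)]); last exact: tens_zero.
by apply/tens_sym/(@tens_scal _ _ _ _ 0); rewrite /= mul0r.
Qed.

Let tens_sumr a (b : nat -> fld S) r :
  teq [:: (a, \sum_(j <- r) b j)] [seq (a, b j) | j <- r].
Proof.
elim: r => [|j r IH]; first by rewrite big_nil; apply: tens_zeror.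
rewrite big_cons; apply: tens_trans (tens_addr _ _ _ _) _.
exact: (tens_cat (tens_refl _ [:: _]) IH).
Qed.

Let tens_standardD a b r :
  teq (standard a r ++ standard b r) (standard (fun j => a j + b j) r).
Proof.
elim: r => [|j r IH]; first exact: tens_refl.
apply: (@tens_trans _ _ _ _ _ ([:: (a j, xpow j); (b j, xpow j)]
   ++ (standard a r ++ standard b r))).
  apply: tens_perm; rewrite /= perm_cons; apply/permP => P /=.
  by rewrite !count_cat /= addnCA.
exact: tens_cat (tens_sym (tens_addl _ _ _ _)) IH.
Qed.

Let tens_standard0 r : teq (standard (fun=> 0) r) [::].
Proof.
elim: r => [|j r IH]; first exact: tens_refl.
exact: (@tens_cat _ _ _ _ [:: _] [::] _ [::] (@tens_zero _ _ _ _ _) IH).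
Qed.

(** Expand each right factor along the powers of [x] and move the coefficients, which are in [F], to
    the left factor. *)
Lemma tens_standardP t : exists a, teq t (standard a (iota 0 s)).
Proof.
elim: t => [|[a b] t [ct tt]].
  by exists (fun=> 0); apply/tens_sym/tens_standard0.
have [c cE] : spans F (fun i : 'I_s => x ^+ i) (val b).
  by apply: (minp_span Fx sh); rewrite -eS fld_valP.
pose c' j : fld F := if insub j is Some i then c i else 0.
have Mca j : val (c' j) * val a \in M by rewrite rpredM ?fld_valP // sFM ?fld_valP.
have Scx j : val (c' j) * x ^+ j \in S.
  by rewrite rpredM ?rpredX // sFS ?fld_valP.
have eb : b = \sum_(j <- iota 0 s) Fld (Scx j).
  apply: val_inj; rewrite cE rmorph_sum /= -[s in iota 0 s]subn0.
  rewrite -/(index_iota 0 s) big_mkord; apply: eq_bigr => i _.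
  by rewrite /c' valK.
have [a' ta'] : exists a', teq [:: (a, b)] (standard a' (iota 0 s)).
  exists (fun j => Fld (Mca j)); rewrite eb; apply: tens_trans (tens_sumr _ _ _) _.
  elim: (iota 0 s) => [|j r IH]; first exact: tens_refl.
  apply: (@tens_cat _ _ _ _ [:: _] [:: _] _ _ _ IH); apply: tens_sym.
  exact: (@tens_scal _ _ _ _ (c' j)).
exists (fun j => a' j + ct j); apply: tens_trans (tens_standardD _ _ _).
exact: (tens_cat ta' tt).
Qed.

Let tens_sum_standard a :
  tens_sum (standard a (iota 0 s)) = \sum_(j < s) val (a j) * x ^+ j.
Proof.
rewrite /tens_sum big_map -[s in iota 0 s]subn0 -/(index_iota 0 s).
by rewrite big_mkord.
Qed.

(** Two tensors with the same image have the same normal form, because the powers of [x] are free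
    over [M]; they also span [E] over [M], which gives surjectivity. *)
Lemma tensor_iso_disjoint : natural_tensor_iso F M S E.
Proof.
split=> [u v|y].
  rewrite /tensor_mul; have [a ta] := tens_standardP (repr u).
  have [b tb] := tens_standardP (repr v).
  rewrite (tens_sum_eq ta) (tens_sum_eq tb) !tens_sum_standard => eab.
  have ab j : (j < s)%N -> a j = b j.
    move=> lt_j; apply/subr0_eq.
    apply: (minp_free Mx sh (c := fun i => a i - b i) _ (Ordinal lt_j)).
    transitivity (\sum_(i < s) val (a i) * x ^+ i - \sum_(i < s) val (b i) * x ^+ i).
      by rewrite -sumrB; apply: eq_bigr => i _; rewrite rmorphB mulrBl.
    by rewrite eab subrr.
  rewrite -[u]reprK -[v]reprK; apply/(@eqmodP _ (tens_equiv F M S))/asboolP.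
  apply: (tens_trans ta); apply: tens_sym.
  rewrite (_ : standard a (iota 0 s) = standard b (iota 0 s)) //.
  by apply/eq_in_map => j; rewrite mem_iota => /ab ->.
split=> [|[u <-]]; last first.
  apply: rpred_sum => ab _.
  exact: rpredM (sME (fld_valP ab.1)) (sSE (fld_valP ab.2)).
rewrite eE => /(minp_span Mx sh)[a ->].
exists (\pi_(tensor F M S)
  (standard (fun j => if insub j is Some i then a i else 0) (iota 0 s))).
rewrite tensor_mulE tens_sum_standard; apply: eq_bigr => i _.
by rewrite valK.
Qed.

End LinearDisjointness.

(** A basis is pushed forward by [phi], while scalars and vectors are pulled back by its inverse.
    This serves for the invariance of [m_ext]. *)
Lemma ext_degree_morph (T T' : fieldType) (F M E : divringClosed T)
    (F' M' E' : divringClosed T') (phi : {rmorphism fld E -> fld E'}) d :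
    bijective phi -> {subset M <= E} -> {subset M' <= E'} -> {subset F' <= M'} ->
    (forall x, (val x \in F) = (val (phi x) \in F')) ->
    (forall x, (val x \in M) = (val (phi x) \in M')) ->
  ext_degree F M d -> ext_degree F' M' d.
Proof.
case=> psi phiK psiK sME sME' sFM' phiF phiM /ext_degreeP[sFM [b [Mb fb sb]]].
have bE i : b i \in E by apply: sME.
have sumE (c : 'I_d -> fld E) :
    val (phi (\sum_i c i * Fld (bE i))) =
    \sum_i val (phi (c i)) * val (phi (Fld (bE i))).
  by rewrite !rmorph_sum /=; apply: eq_bigr => i _; rewrite !rmorphM.
apply/ext_degreeP; split=> //.
exists (fun i => val (phi (Fld (bE i)))); split=> [i|c|y M'y].
- by rewrite -phiM; apply: Mb.
- have Ec i : val (c i) \in E' by rewrite sME' ?sFM' ?fld_valP.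
  pose c' i := psi (Fld (Ec i)).
  have Fc i : val (c' i) \in F by rewrite phiF psiK; apply: (fld_valP (c i)).
  move=> c0; have : \sum_i c' i * Fld (bE i) = 0.
    apply: (can_inj phiK); apply: val_inj; rewrite sumE !rmorph0 -[RHS]c0.
    by apply: eq_bigr => i _; rewrite psiK.
  move=> /(congr1 val); rewrite rmorph_sum /= => c'0 i.
  have /(_ _ i)/(congr1 val) /= c'i0 := fb (fun i => Fld (Fc i)).
  apply: val_inj => /=.
  have -> : val (c i) = val (phi (c' i)) by rewrite psiK.
  rewrite (_ : c' i = 0) ?rmorph0 //; apply: val_inj; apply: c'i0.
  exact: c'0.
have E'y := sME' _ M'y; pose x := psi (Fld E'y).
have Mx : val x \in M by rewrite phiM psiK.
have [c cE] := sb _ Mx.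
have Ec i : val (c i) \in E by rewrite sME ?sFM ?fld_valP.
have Fc i : val (phi (Fld (Ec i))) \in F' by rewrite -phiF; apply: (fld_valP (c i)).
exists (fun i => Fld (Fc i)); rewrite /= -(sumE (fun i => Fld (Ec i))).
rewrite -[LHS]/(val (Fld E'y)) -[Fld E'y]psiK; congr (val (phi _)).
by apply: val_inj; rewrite rmorph_sum -[LHS]/(val x) cE.
Qed.

(** The hypothesis at [0] makes the range nonempty, so that the maximum is attained and is not just
    the default [0]. *)
Lemma bigmax_ord_max (P : pred nat) k (m := (\max_(i < k.+1 | P i) i)%N) :
  P 0%N -> [/\ (m <= k)%N, P m & forall j, (j <= k)%N -> P j -> (j <= m)%N].
Proof.
move=> P0; rewrite /m; split=> [||j le_j Pj].
- by apply/bigmax_leqP => i _; rewrite -ltnS.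
- have [|i Pi ->] := @eq_bigmax_cond _ (fun i : 'I_k.+1 => P i) (@nat_of_ord _) => //.
  by apply/card_gt0P; exists ord0.
have lt_j : (j < k.+1)%N by rewrite ltnS.
exact: (leq_bigmax_cond (F := @nat_of_ord _) (Ordinal lt_j)).
Qed.

Lemma purely_insep_ext_refl (T : fieldType) p (F : divringClosed T) :
  purely_insep_ext p F F.
Proof. by move=> x Fx; exists 0%N. Qed.

(** * Roots of the coefficients of [fsep] and separability of powers of [theta] *)

Section Setting.
Variables (T : closedFieldType) (p : nat) (K : divringClosed T) (theta : T).
Variables (f fsep : {poly fld K}) (n : nat) (N0 : divringClosed T).
Hypothesis H : setting p theta f fsep n N0.
Implicit Types (F E X : divringClosed T) (x y : T) (h : {poly T}).

Local Notation s := (sep_degree fsep).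
Local Notation lam := (sep_coef fsep).
Local Notation root_poly := (root_poly p s lam).
Local Notation roots_in := (roots_in p s lam).
Local Notation fsepT := (map_poly (val : fld K -> T) fsep).
Local Notation th k := (theta ^+ (p ^ k)).

Lemma setting_pchar : p \in [pchar T].
Proof. by rewrite (fmorph_pchar (val : fld K -> T)) (setting_char H). Qed.

Local Notation pT := setting_pchar.

Lemma setting_minp F x : {subset K <= F} -> exists h, minp F x h.
Proof.
move=> sKF; have [q nzq rq] := setting_closure H x.
apply: minp_exists rq; last by rewrite map_poly_eq0.
exact: polyOver_sub sKF (polyOver_val _).
Qed.

Lemma setting_theta_root : root fsepT (th n).
Proof.
have [_ + _] := setting_f_minimal H; rewrite (setting_f_presentation H).
by rewrite map_comp_poly map_polyXn rootE horner_comp hornerXn.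
Qed.

(** If [Q] vanishes at [th n], then [Q \Po 'X^(p ^ n)] vanishes at [theta] and is divisible by [f];
    the degrees are then compared after cancelling [p ^ n]. *)
Lemma minp_fsep : minp K (th n) fsepT.
Proof.
have pn_gt0 : (0 < p ^ n)%N by rewrite expn_gt0 (prime_gt0 (pcharf_prime pT)).
have [mf rf df] := setting_f_minimal H; have ef := setting_f_presentation H.
apply: minp_intro setting_theta_root _; first exact: polyOver_val.
  rewrite map_monic; move: mf; rewrite ef !monicE lead_coef_comp ?size_polyXn //.
  by rewrite lead_coefXn expr1n mulr1.
move=> P /polyOver_lift[Q <-] rQ; rewrite map_poly_eq0 => nzQ.
have nzQX : Q \Po 'X^(p ^ n) != 0.
  by rewrite comp_poly_eq0 ?size_polyXn.
have := dvdp_leq nzQX (df (Q \Po 'X^(p ^ n)) _).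
rewrite map_comp_poly map_polyXn rootE horner_comp hornerXn => /(_ rQ).
have szf : (0 < size f)%N by rewrite size_poly_gt0 monic_neq0.
rewrite -(prednK szf) -(prednK (_ : 0 < size (Q \Po _))%N) ?size_poly_gt0 // ltnS.
have := size_comp_poly Q 'X^(p ^ n); have := size_comp_poly fsep 'X^(p ^ n).
rewrite size_polyXn -ef => -> ->; rewrite (leq_pmul2r pn_gt0) !size_map_poly.
have szQ : (0 < size Q)%N by rewrite size_poly_gt0.
have szs : (0 < size fsep)%N.
  by rewrite size_poly_gt0 (separable_poly_neq0 (setting_fsep_separable H)).
by rewrite -ltnS !prednK.
Qed.

Lemma size_fsep : size fsepT = s.+1.
Proof.
rewrite size_map_poly prednK // -(size_map_poly (val : fld K -> T)) ltnW //.
exact: minp_size_gt1 minp_fsep.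
Qed.

Lemma fsep_coef i : fsepT`_i = lam i.
Proof. by rewrite coef_map. Qed.

Lemma separable_fsep : separable_poly fsepT.
Proof. by rewrite separable_map (setting_fsep_separable H). Qed.

Lemma lam_lead : lam s = 1.
Proof.
have := minp_monic minp_fsep.
by rewrite monicE lead_coefE size_fsep fsep_coef => /eqP.
Qed.

Lemma lam_base i : lam i \in K.
Proof. exact: fld_valP. Qed.

Lemma proot_exp k x : proot p k (x ^+ (p ^ k)) = x.
Proof.
apply: (@frob_inj T p pT k); rewrite /= !frobE prootK //.
exact: prime_gt0 (pcharf_prime pT).
Qed.

Lemma exp_proot k x : proot p k x ^+ (p ^ k) = x.
Proof. by rewrite prootK // (prime_gt0 (pcharf_prime pT)). Qed.

Lemma proot1 k : proot p k 1 = 1 :> T.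
Proof. by rewrite -[X in proot _ _ X](expr1n _ (p ^ k)) proot_exp. Qed.

Lemma size_root_poly k : size (root_poly k) = s.+1.
Proof. by rewrite size_poly_eq // lam_lead proot1 oner_eq0. Qed.

Lemma root_poly_monic k : root_poly k \is monic.
Proof.
by rewrite monicE lead_coefE size_root_poly coef_poly ltnSn lam_lead proot1.
Qed.

Lemma frob_root_poly k : map_poly (frob pT k) (root_poly k) = fsepT.
Proof.
apply/polyP => i; rewrite coef_map fsep_coef coef_poly; case: ltnP => [_|lti].
  by rewrite /= frobE exp_proot.
by rewrite raddf0 -fsep_coef nth_default // size_fsep.
Qed.

(** Only [i < s] is tested by [roots_in]; the coefficient is [1] at [s] and [0] beyond, and their
    roots are in every subfield. *)
Lemma roots_inP k F :
  reflect (forall i, proot p k (lam i) \in F) (roots_in k F).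
Proof.
apply: (iffP forallP) => [rF i|rF i]; last exact: rF.
have [lti|lei] := ltnP i s; first exact: (rF (Ordinal lti)).
move: lei; rewrite leq_eqVlt => /predU1P[<-|lti].
  by rewrite lam_lead proot1 rpred1.
have -> : lam i = 0 by rewrite -fsep_coef nth_default // size_fsep.
have e0 : 0 ^+ (p ^ k) = 0 :> T.
  by rewrite expr0n gtn_eqF // expn_gt0 (prime_gt0 (pcharf_prime pT)).
by rewrite -e0 proot_exp rpred0.
Qed.

Lemma roots_in_sub k F E : {subset F <= E} -> roots_in k F -> roots_in k E.
Proof. by move=> sFE /roots_inP rF; apply/roots_inP => i; apply: sFE. Qed.

Lemma roots_in0 F : {subset K <= F} -> roots_in 0 F.
Proof.
move=> sKF; apply/roots_inP => i; apply: sKF.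
by rewrite -[X in proot _ _ X]expr1 -(expn0 p) proot_exp lam_base.
Qed.

Lemma separable_theta F : {subset K <= F} -> separable_over F (th n).
Proof.
move=> sKF; apply: separable_over_sub sKF _.
apply/separable_over_minp; exists fsepT; first exact: minp_fsep.
exact: separable_fsep.
Qed.

(** The sum of the exponents of the finitely many coefficients serves for all of them; adding [j]
    makes it at least [j]. *)
Lemma poly_pi_ext F h j :
    {subset K <= F} -> purely_insep_ext p K F -> h \is a polyOver F ->
  exists2 k, (j <= k)%N & map_poly (frob pT k) h \is a polyOver K.
Proof.
move=> sKF piF /polyOverP Fh.
have [e eP] := choice (fun i => piF _ (Fh i)).
exists (j + \sum_(i < size h) e i)%N; first exact: leq_addr.
apply/polyOverP => i; rewrite coef_map /= frobE.
have [lti|lei] := ltnP i (size h); last first.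
  rewrite nth_default // expr0n gtn_eqF ?rpred0 //.
  by rewrite expn_gt0 (prime_gt0 (pcharf_prime pT)).
rewrite (bigD1 (Ordinal lti)) //= addnCA expr_pD rpredX //.
Qed.

(* The [p ^ k]-th powers of the coefficients of [h] are in [K] for some
   [k], and [th n ^+ (p ^ (k - j))] still has degree [s] over [K]. *)
Lemma frob_minp F j x h :
    {subset K <= F} -> purely_insep_ext p K F ->
    x ^+ (p ^ j) = th n -> separable_over F x -> minp F x h ->
  map_poly (frob pT j) h = fsepT.
Proof.
move=> sKF piF xj sx hx.
have [g gx] := setting_minp (th n) sKF.
have Ffsep : fsepT \is a polyOver F by apply: polyOver_sub sKF (minp_over minp_fsep).
have nz : fsepT != 0 by apply: minp_neq0 minp_fsep.
have sgh : size g = size h by apply: (minp_size_pexp pT sx hx (k := j)); rewrite xj.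
have sg : (size g <= s.+1)%N.
  by rewrite -size_fsep (minp_size gx) ?setting_theta_root.
have [k le_jk Kh] := poly_pi_ext j sKF piF (minp_over hx).
have [u ux] := setting_minp (th n ^+ (p ^ (k - j))) (fun _ => id).
have su : size u = s.+1.
  rewrite -size_fsep; apply: (minp_size_pexp pT _ minp_fsep ux).
  exact: separable_theta.
have hs : (s.+1 <= size h)%N.
  rewrite -su -(size_map_poly (frob pT k) h); apply: (minp_size ux) => //.
    by rewrite -xj -expr_pD subnKC // root_map_frob // (minp_root hx).
  by rewrite map_poly_eq0 (minp_neq0 hx).
(* Both sides are identified with [g], the minimal polynomial of [th n] over [F]. *)
have eq_g q :
    q \is a polyOver F -> q \is monic -> root q (th n) -> size q = s.+1 ->
  q = g.
  by move=> Fq mq rq sq; apply: (minp_eq gx) => //; rewrite sq sgh.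
rewrite [LHS]eq_g ?[RHS]eq_g ?size_fsep ?(minp_monic minp_fsep)
  ?setting_theta_root //.
- by apply: map_frob_over; apply: minp_over hx.
- by rewrite map_monic (minp_monic hx).
- by rewrite -xj root_map_frob // (minp_root hx).
- by rewrite size_map_poly; apply/eqP; rewrite eqn_leq hs -sgh sg.
Qed.

Lemma theta_exp j : (j <= n)%N -> th (n - j) ^+ (p ^ j) = th n.
Proof. by move=> le_j; rewrite -expr_pD subnK. Qed.

(** By [frob_minp], the coefficients of the minimal polynomial of [th (n - j)] are the roots in
    question. *)
Lemma roots_in_separable F j :
    {subset K <= F} -> purely_insep_ext p K F -> (j <= n)%N ->
  separable_over F (th (n - j)) -> roots_in j F.
Proof.
move=> sKF piF le_j sx; have [h hx] := setting_minp (th (n - j)) sKF.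
have ehf := frob_minp sKF piF (theta_exp le_j) sx hx.
apply/roots_inP => i; rewrite -fsep_coef -ehf coef_map /= frobE proot_exp.
by have /polyOverP := minp_over hx; apply.
Qed.

Section RootsIn.
Variables (F : divringClosed T) (j : nat).
Hypotheses (sKF : {subset K <= F}) (piF : purely_insep_ext p K F).
Hypotheses (le_j : (j <= n)%N) (rF : roots_in j F).

Let rpF : root_poly j \is a polyOver F.
Proof.
apply/polyOverP => i; rewrite coef_poly; case: ltnP => _; last exact: rpred0.
exact: roots_inP.
Qed.

Let rp_root : root (root_poly j) (th (n - j)).
Proof.
rewrite -(fmorph_root (frob pT j)) frob_root_poly /= frobE theta_exp //.
exact: setting_theta_root.
Qed.

Lemma separable_roots_in : separable_over F (th (n - j)).
Proof.
apply: separable_over_root rpF _ rp_root.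
by rewrite -(separable_map (frob pT j)) frob_root_poly separable_fsep.
Qed.

Lemma minp_root_poly : minp F (th (n - j)) (root_poly j).
Proof.
have [h hx] := setting_minp (th (n - j)) sKF.
rewrite (minp_eq hx rpF (root_poly_monic _) rp_root) // size_root_poly.
rewrite -size_fsep -(size_map_poly (frob pT j) h).
by rewrite (frob_minp sKF piF (theta_exp le_j) separable_roots_in hx).
Qed.

End RootsIn.

Section MaximalRoots.
Variables (F X : divringClosed T) (mu : nat).
Hypotheses (sKF : {subset K <= F}) (piF : purely_insep_ext p K F).
Hypotheses (le_mu : (mu <= n)%N) (rF : roots_in mu F).
Hypothesis max_mu : forall j, (j <= n)%N -> roots_in j F -> (j <= mu)%N.
Hypothesis eX : X =i adjoin1 F theta.

Let sFX : {subset F <= X}.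
Proof. by move=> y Fy; rewrite eX adjoin_base. Qed.

Lemma exp_mem_adjoin :
  {in X, forall y, y ^+ (p ^ (n - mu)) \in adjoin1 F (th (n - mu))}.
Proof.
move=> y; rewrite eX; apply: (frob_adjoin pT) => [z Fz|z ->].
  by rewrite rpredX // adjoin_base.
exact: adjoin1_gen.
Qed.

(** An element of [X] separable over [F] is, by [exp_mem_adjoin], also purely inseparable over
    [F(th (n - mu))], hence lies in it. *)
Lemma max_sep_roots : max_sep F X =i adjoin1 F (th (n - mu)).
Proof.
have sg := separable_roots_in le_mu rF.
move=> y; apply/idP/idP => [/(mem_max_sep _ sFX)[Xy sy]|Fy].
  apply: (separable_pi_mem pT _ (exp_mem_adjoin Xy)).
  by apply: separable_over_sub sy; apply: adjoin_base.
apply/(mem_max_sep _ sFX); split; last exact: separable_adjoin1 Fy.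
by apply: adjoin1_least Fy => //; rewrite rpredX // eX adjoin1_gen.
Qed.

(** If [e < n - mu], then [th e] would be separable over [F], so that the roots of order
    [n - e > mu] would be in [F], against the maximality of [mu]. *)
Lemma theta_exp_mem e : th e \in adjoin1 F (th (n - mu)) -> (n - mu <= e)%N.
Proof.
move=> /(separable_adjoin1 (separable_roots_in le_mu rF)) se.
rewrite leqNgt; apply/negP => lt_e.
have le_en : (e <= n)%N by rewrite (leq_trans (ltnW lt_e)) ?leq_subr.
have /max_mu : roots_in (n - e) F.
  by apply: roots_in_separable; rewrite ?leq_subr ?subKn.
by rewrite leq_subr leqNgt ltn_subRL addnC -ltn_subRL lt_e => /(_ isT).
Qed.

Lemma minp_theta (S : divringClosed T) : S =i adjoin1 F (th (n - mu)) ->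
  minp S theta ('X^(p ^ (n - mu)) - (th (n - mu))%:P).
Proof.
move=> eS; apply: (minp_pure_insep pT) => [|e]; rewrite eS.
  exact: adjoin1_gen.
exact: theta_exp_mem.
Qed.

End MaximalRoots.
End Setting.

(** * The separable and purely inseparable parts of [X] over [N], where [X] is [N(theta)] *)

Section Main.
Variables (T : closedFieldType) (p : nat) (K : divringClosed T) (theta : T).
Variables (f fsep : {poly fld K}) (n : nat) (N X : divringClosed T).
Hypothesis H : setting p theta f fsep n N.
Hypothesis eX : X =i adjoin1 N theta.

Local Notation s := (sep_degree fsep).
Local Notation lam := (sep_coef fsep).
Local Notation root_poly := (root_poly p s lam).
Local Notation roots_in := (roots_in p s lam).
Local Notation th k := (theta ^+ (p ^ k)).
Local Notation m1 := (m_base p s n lam N).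
Local Notation m2 := (m_ext p s n lam N X).
Local Notation M := (max_pi p N X).
Local Notation S := (max_sep N X).
Local Notation E := (compositum M S).
Local Notation M' := (adjoin_roots p s lam N (m1 + m2)).
Local Notation alpha := (th (n - m1)).
Local Notation beta := (th (n - m1 - m2)).

Let pT : p \in [pchar T] := setting_pchar H.

Let sKN : {subset K <= N}.
Proof. exact: setting_N_ext H. Qed.

Let piN : purely_insep_ext p K N.
Proof. exact: setting_N_pi H. Qed.

Let sNX : {subset N <= X}.
Proof. by move=> y Ny; rewrite eX adjoin_base. Qed.

Let Xtheta : theta \in X.
Proof. by rewrite eX adjoin1_gen. Qed.

Lemma m_base_max :
  [/\ (m1 <= n)%N, roots_in m1 N
    & forall j, (j <= n)%N -> roots_in j N -> (j <= m1)%N].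
Proof. exact: (bigmax_ord_max (P := roots_in^~ N) n (roots_in0 H sKN)). Qed.

Let le_m1 : (m1 <= n)%N. Proof. by case: m_base_max. Qed.
Let rN : roots_in m1 N. Proof. by case: m_base_max. Qed.
Let max_m1 : forall j, (j <= n)%N -> roots_in j N -> (j <= m1)%N.
Proof. by case: m_base_max. Qed.

Lemma m_ext_max :
  [/\ (m2 <= n - m1)%N, roots_in (m1 + m2) X
    & forall j, (j <= n - m1)%N -> roots_in (m1 + j) X -> (j <= m2)%N].
Proof.
apply: (bigmax_ord_max (P := fun j => roots_in (m1 + j) X)).
by rewrite addn0 (roots_in_sub H sNX).
Qed.

Let le_m2 : (m2 <= n - m1)%N. Proof. by case: m_ext_max. Qed.
Let le_mu : (m1 + m2 <= n)%N. Proof. by rewrite -leq_subRL. Qed.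

Let sNM : {subset N <= M}. Proof. by case: (max_piP pT sNX). Qed.
Let sMX : {subset M <= X}. Proof. by case: (max_piP pT sNX). Qed.
Let sKM : {subset K <= M}. Proof. by move=> y /sKN/sNM. Qed.

Let sNS : {subset N <= S}. Proof. by case: (max_sepP sNX). Qed.
Let sSX : {subset S <= X}. Proof. by case: (max_sepP sNX). Qed.

Let sEX : {subset E <= X}. Proof. exact: compositum_least. Qed.

Let piM : purely_insep_ext p K M.
Proof.
move=> y /(mem_max_pi pT _ sNX)[_ [k /piN[l Kl]]].
by exists (k + l)%N; rewrite expr_pD.
Qed.

(** Such a root has a power in [K], so it is purely inseparable over [N]. *)
Let roots_inM j : roots_in j X -> roots_in j M.
Proof.
move=> /(roots_inP H) rX; apply/(roots_inP H) => i.
apply/(mem_max_pi pT _ sNX); split=> //; exists j.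
by rewrite (exp_proot H); apply/sKN/lam_base.
Qed.

Let rM : roots_in (m1 + m2) M.
Proof. by apply: roots_inM; case: m_ext_max. Qed.

(** The definition of [m2] only tests exponents from [m1] on; smaller ones satisfy the bound
    trivially. *)
Let max_mu j : (j <= n)%N -> roots_in j M -> (j <= m1 + m2)%N.
Proof.
move=> le_j /(roots_in_sub H sMX) rX; have [le_jm|/ltnW lt_mj] := leqP j m1.
  exact: leq_trans le_jm (leq_addr _ _).
case: m_ext_max => _ _ /(_ (j - m1)%N); rewrite subnKC // leq_sub2r //.
by move=> /(_ isT rX); rewrite leq_subLR.
Qed.

Let adjoinX (F : divringClosed T) :
  {subset N <= F} -> {subset F <= X} -> X =i adjoin1 F theta.
Proof.
move=> sNF sFX y; apply/idP/idP => [|]; last exact: adjoin1_least.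
rewrite eX; apply: adjoin1_least; last exact: adjoin1_gen.
by move=> z /sNF; apply: adjoin_base.
Qed.

Lemma max_sep_alpha : S =i adjoin1 N alpha.
Proof. exact: (max_sep_roots H le_m1 rN eX). Qed.

Let minp_alpha : minp N alpha (root_poly m1).
Proof. exact: (minp_root_poly H). Qed.

Let minpM_beta : minp M beta (root_poly (m1 + m2)).
Proof. by rewrite -subnDA; apply: (minp_root_poly H). Qed.

Let max_sepM_beta : max_sep M X =i adjoin1 M beta.
Proof.
rewrite -subnDA; apply: (max_sep_roots H) => //; exact: adjoinX.
Qed.

Let beta_alpha : beta ^+ (p ^ m2) = alpha.
Proof. by rewrite -expr_pD subnK. Qed.

Let separable_beta : separable_over M beta.
Proof. by rewrite -subnDA; apply: (separable_roots_in H). Qed.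

(** As [beta] is separable over [M], it generates the same field over [M] as its power [alpha]. *)
Lemma compositum_beta : E =i adjoin1 M beta.
Proof.
move=> y; rewrite -(adjoin1_pexp pT m2 separable_beta) beta_alpha.
apply/idP/idP; last first.
  apply: adjoin1_least; first exact: compositum_l.
  by apply: compositum_r; rewrite max_sep_alpha adjoin1_gen.
apply: compositum_least; first exact: adjoin_base.
move=> z; rewrite max_sep_alpha; apply: adjoin1_least; last exact: adjoin1_gen.
by move=> t /sNM; apply: adjoin_base.
Qed.

Lemma max_sep_pi : max_sep M X =i E.
Proof. by move=> y; rewrite compositum_beta max_sepM_beta. Qed.

Lemma minp_theta_compositum :
  minp E theta ('X^(p ^ (n - m1 - m2)) - beta%:P).
Proof.
rewrite -!subnDA; apply: (minp_theta H sKM piM le_mu rM max_mu).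
by rewrite subnDA; apply: compositum_beta.
Qed.

Let sNM' : {subset N <= M'}. Proof. exact: adjoin_base. Qed.

Let sM'M : {subset M' <= M}.
Proof. by apply: adjoin_least => // y [i ->]; apply: (roots_inP H). Qed.

Let rM' : roots_in (m1 + m2) M'.
Proof. by apply/forallP => i; apply: adjoin_gen; exists i. Qed.

Let max_mu' j : (j <= n)%N -> roots_in j M' -> (j <= m1 + m2)%N.
Proof. by move=> le_j /(roots_in_sub H sM'M); apply: max_mu. Qed.

Let sKM' : {subset K <= M'}. Proof. by move=> y /sKN/sNM'. Qed.

Let piM' : purely_insep_ext p K M'. Proof. by move=> y /sM'M/piM. Qed.

Lemma max_pi_roots : M =i M'.
Proof.
have minpM'_beta : minp M' beta (root_poly (m1 + m2)).
  by rewrite -subnDA; apply: (minp_root_poly H).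
have thM : minp (adjoin1 M beta) theta ('X^(p ^ (n - m1 - m2)) - beta%:P).
  by rewrite -!subnDA; apply: (minp_theta H sKM piM).
have thM' : minp (adjoin1 M' beta) theta ('X^(p ^ (n - m1 - m2)) - beta%:P).
  by rewrite -!subnDA; apply: (minp_theta H sKM' piM').
have sM'beta : {subset adjoin1 M' beta <= adjoin1 M beta}.
  by apply: adjoin1_least => [y /sM'M|]; [apply: adjoin_base | apply: adjoin1_gen].
(* First descent, with [theta]: it has the same minimal polynomial over [M(beta)] and over
   [M'(beta)]. *)
have sMbeta : {subset adjoin1 M beta <= adjoin1 M' beta}.
  apply: minp_sub thM (minp_over thM') (minp_root thM') (minp_neq0 thM') _ => //.
  move=> y; rewrite -compositum_beta => /sEX; rewrite eX.
  apply: adjoin1_least; last exact: adjoin1_gen.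
  by move=> z /sNM' M'z; do 2!apply: adjoin_base.
move=> y; apply/idP/idP; last exact: sM'M.
(* Second descent, with [beta]: its minimal polynomial is [root_poly (m1 + m2)] over both [M] and
   [M']. *)
apply: (minp_sub sM'M _ minpM_beta (minp_over minpM'_beta)) => //.
- by move=> z Mz; apply/sMbeta/adjoin_base.
- exact: minp_root minpM'_beta.
- exact: minp_neq0 minpM'_beta.
Qed.

(** The minimal polynomial of [theta] over [E] already has its coefficients in [S(beta)], so
    [minp_sub] brings [E] down to that field. *)
Let compositum_sep_beta : E =i adjoin1 S beta.
Proof.
have thE := minp_theta_compositum.
have Ebeta : beta \in E by rewrite compositum_beta adjoin1_gen.
have sSE : {subset adjoin1 S beta <= E}.
  by apply: adjoin1_least => //; apply: compositum_r.
move=> y; apply/idP/idP; last exact: sSE.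
apply: minp_sub sSE _ thE _ (minp_root thE) (minp_neq0 thE) (leqnn _) y.
  move=> y /sEX; rewrite eX; apply: adjoin1_least; last exact: adjoin1_gen.
  by move=> z /sNS Sz; do 2!apply: adjoin_base.
by apply: XsubC_over; apply: adjoin1_gen.
Qed.

Let size_Xpn k (c : T) : size ('X^(p ^ k) - c%:P) = (p ^ k).+1.
Proof. by rewrite size_XnsubC // expn_gt0 (prime_gt0 (pcharf_prime pT)). Qed.

Lemma degree_sep_compositum : ext_degree S E (p ^ m2).
Proof.
have minp_beta : minp S beta ('X^(p ^ m2) - (beta ^+ (p ^ m2))%:P).
  apply: (minp_pure_insep pT) => [|e].
    by rewrite beta_alpha max_sep_alpha adjoin1_gen.
  (* No smaller power of [beta] is in [S]: by [theta_exp_mem], [th (n - m1 - m2 + e)] is in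
     [N(alpha)] only if [m2 <= e]. *)
  rewrite -expr_pD max_sep_alpha => /(theta_exp_mem H sKN piN le_m1 rN max_m1).
  by rewrite -{1}(subnK le_m2) leq_add2l.
apply: ext_degree_eq (fun y => esym (compositum_sep_beta y)) _.
exact: minp_degree minp_beta (size_Xpn _ _).
Qed.

Let minpM_alpha : minp M alpha (root_poly m1).
Proof.
exact: (minp_root_poly H sKM piM le_m1 (roots_in_sub H sNM rN)).
Qed.

Let compositum_alpha : E =i adjoin1 M alpha.
Proof.
by move=> y; rewrite compositum_beta -(adjoin1_pexp pT m2 separable_beta) beta_alpha.
Qed.

(** Since [alpha] has the minimal polynomial [root_poly m1] over both [N] and [M], linear
    disjointness turns the degree of [E] over [S] into that of [M] over [N]. *)
Lemma degree_pi : ext_degree N M (p ^ m2).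
Proof.
apply: (disjoint_degree sNM minp_alpha minpM_alpha (size_root_poly H _)
  max_sep_alpha compositum_alpha).
exact: degree_sep_compositum.
Qed.

Lemma tensor_iso_compositum : natural_tensor_iso N M S E.
Proof.
exact: (tensor_iso_disjoint sNM minp_alpha minpM_alpha (size_root_poly H _)
  max_sep_alpha compositum_alpha).
Qed.

Lemma presented_sep : presented_by N (root_poly m1) alpha S.
Proof. exact: presented_by_minp minp_alpha max_sep_alpha. Qed.

Lemma degree_sep : ext_degree N S s.
Proof.
apply: ext_degree_eq (fun y => esym (max_sep_alpha y)) _.
exact: minp_degree minp_alpha (size_root_poly H _).
Qed.

Lemma presented_compositum : presented_by M (root_poly (m1 + m2)) beta E.
Proof. exact: presented_by_minp minpM_beta compositum_beta. Qed.

Lemma degree_pi_compositum : ext_degree M E s.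
Proof.
apply: ext_degree_eq (fun y => esym (compositum_beta y)) _.
exact: minp_degree minpM_beta (size_root_poly H _).
Qed.

Lemma adjoin_compositum : X =i adjoin1 E theta.
Proof.
by apply: adjoinX => // y /sNM My; apply: compositum_l.
Qed.

Lemma presented_top :
  presented_by E ('X^(p ^ (n - m1 - m2)) - beta%:P) theta X.
Proof. exact: presented_by_minp minp_theta_compositum adjoin_compositum. Qed.

Lemma degree_top : ext_degree E X (p ^ (n - m1 - m2)).
Proof.
apply: ext_degree_eq (fun y => esym (adjoin_compositum y)) _.
exact: minp_degree minp_theta_compositum (size_Xpn _ _).
Qed.

Lemma exp_mem_compositum e :
  th e \in E <-> forall y, y \in X -> y ^+ (p ^ e) \in E.
Proof.
split=> [Ee y|]; last exact.
rewrite adjoin_compositum; apply: (frob_adjoin pT) => [z Ez|z ->//].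
by rewrite rpredX.
Qed.

Lemma theta_exp_compositum e : th e \in E <-> (n - m1 - m2 <= e)%N.
Proof.
split=> [|le_e].
  by rewrite compositum_beta -subnDA; apply: (theta_exp_mem H sKM piM).
by rewrite -(subnKC le_e) expr_pD rpredX // compositum_beta adjoin1_gen.
Qed.

Lemma exponent_top : pi_exponent p E X (n - m1 - m2).
Proof.
split=> [|e /exp_mem_compositum/theta_exp_compositum //].
exact/exp_mem_compositum/theta_exp_compositum.
Qed.

Lemma m_ext_theta_max :
  is_max (fun j => (j <= n - m1)%N /\ th (n - m1 - j) \in E) m2.
Proof.
split=> [|j [le_j /theta_exp_compositum le_mj]].
  by split=> //; apply/theta_exp_compositum.
by lia.
Qed.

Lemma m_ext_exp_max :
  is_max (fun j => (j <= n - m1)%N /\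
    forall y, y \in X -> y ^+ (p ^ (n - m1 - j)) \in E) m2.
Proof.
have [[le_2 E2] max2] := m_ext_theta_max; split=> [|j [le_j Ej]].
  by split=> //; apply/exp_mem_compositum.
by apply: max2; split=> //; apply/exp_mem_compositum.
Qed.

(** Over [K] the separable part is [K(th (n - m0))], with [m0] the analogue of [m1] for [K]. As
    [m0 <= m1], its generator is a Frobenius power of [alpha], hence generates the same field over
    [N]. *)
Lemma max_sep_base (L := adjoin1 K theta) : S =i compositum N (max_sep K L).
Proof.
have piK : purely_insep_ext p K K by apply: purely_insep_ext_refl.
have [le_m0 rK _] : [/\ (m_base p s n lam K <= n)%N,
    roots_in (m_base p s n lam K) K & True].
  by have [] := bigmax_ord_max (P := roots_in^~ K) n (roots_in0 H (fun _ => id)).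
set m0 := m_base p s n lam K in le_m0 rK.
have eL := max_sep_roots H le_m0 rK (X := L) (fun=> erefl).
have le_01 : (m0 <= m1)%N by apply: max_m1 => //; apply: (roots_in_sub H) rK.
have e01 : alpha ^+ (p ^ (m1 - m0)) = th (n - m0).
  by rewrite -expr_pD; congr (_ ^+ (p ^ _)); lia.
move=> y; rewrite max_sep_alpha.
rewrite -(adjoin1_pexp pT (m1 - m0) (separable_roots_in H le_m1 rN)) e01.
apply/idP/idP.
  apply: adjoin1_least; first exact: compositum_l.
  by apply: compositum_r; rewrite eL adjoin1_gen.
apply: compositum_least; first exact: adjoin_base.
move=> z; rewrite eL; apply: adjoin1_least; last exact: adjoin1_gen.
by move=> t /sKN; apply: adjoin_base.
Qed.

Lemma max_pi_base_sub (L := adjoin1 K theta) :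
  {subset compositum N (max_pi p K L) <= M}.
Proof.
have sKL : {subset K <= L} by apply: adjoin_base.
apply: compositum_least => // y /(mem_max_pi pT _ sKL)[Ly [k Kk]].
apply/(mem_max_pi pT _ sNX); split; last by exists k; apply: sKN.
by apply: adjoin1_least Ly => // z /sKN/sNX.
Qed.

Lemma adjoin_roots_base : {subset adjoin_roots p s lam N m1 <= N}.
Proof. by apply: adjoin_least => // y [i ->]; apply: (roots_inP H). Qed.

(** Makes the results on [N(theta)] over [N] available for [L] over [K]. *)
Lemma setting_base : setting p theta f fsep n K.
Proof. by case: H => *; split=> //; apply: purely_insep_ext_refl. Qed.

End Main.

(** * Comparison with [L] over [K], invariance, and the assembled statement *)

Lemma compositum_adjoin1 (T : fieldType) (N K : divringClosed T) (x : T) :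
  {subset K <= N} -> compositum N (adjoin1 K x) =i adjoin1 N x.
Proof.
move=> sKN y; apply/idP/idP.
  apply: compositum_least; first exact: adjoin_base.
  apply: adjoin1_least; last exact: adjoin1_gen.
  by move=> z /sKN; apply: adjoin_base.
apply: adjoin1_least; first exact: compositum_l.
exact/compositum_r/adjoin1_gen.
Qed.

(** This is [max_pi_roots] for [L] over [K], followed by adjunction to [N]. The exponent is the one
    of [L] over [K]: the roots of order [m1] are already in [N], while for [N = K] the compositum is
    [Lpi], of degree [p ^ m2] over [K]. *)
Lemma max_pi_base (T : closedFieldType) p (K : divringClosed T) theta
    (f fsep : {poly fld K}) n (N : divringClosed T) (L := adjoin1 K theta)
    (s := sep_degree fsep) (lam := sep_coef fsep) :
    setting p theta f fsep n N ->
  compositum N (max_pi p K L) =i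
    adjoin_roots p s lam N (m_base p s n lam K + m_ext p s n lam K L).
Proof.
move=> H; have eq_pi := max_pi_roots (setting_base H) (X := L) (fun=> erefl).
move=> y; apply/idP/idP.
  apply: compositum_least; first exact: adjoin_base.
  move=> z; rewrite eq_pi; apply: adjoin_least => [t /(setting_N_ext H)|t At].
    exact: adjoin_base.
  exact: adjoin_gen.
apply: adjoin_least; first exact: compositum_l.
by move=> z Az; apply: compositum_r; rewrite eq_pi; apply: adjoin_gen.
Qed.

(** The degree of the maximal purely inseparable subextension is [p ^ m2] by [degree_pi], and [phi]
    respects that subextension. *)
Lemma m_ext_invariant (T T' : closedFieldType) p p'
    (K : divringClosed T) (K' : divringClosed T') theta theta'
    (f fsep : {poly fld K}) (f' fsep' : {poly fld K'}) n n'
    (N X : divringClosed T) (N' X' : divringClosed T')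
    (phi : {rmorphism fld X -> fld X'}) :
    setting p theta f fsep n N -> setting p' theta' f' fsep' n' N' ->
    X =i adjoin1 N theta -> X' =i adjoin1 N' theta' -> bijective phi ->
    (forall x : fld X, (val x \in N) = (val (phi x) \in N')) ->
  m_ext p' (sep_degree fsep') n' (sep_coef fsep') N' X' =
  m_ext p (sep_degree fsep) n (sep_coef fsep) N X.
Proof.
move=> H H' eX eX' bij_phi phiN.
have pT := setting_pchar H; have pT' := setting_pchar H'.
(* The two primes agree, being the characteristics of isomorphic fields. *)
have epp : p' = p.
  have pX : p \in [pchar fld X'].
    by rewrite (rmorph_pchar phi) // -(fmorph_pchar (val : fld X -> T)).
  have pTp : p \in [pchar T'] by rewrite (fmorph_pchar (val : fld X' -> T')).
  by move: (pTp); rewrite (pcharf_eq pT') => /eqP.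
subst p'; have p_gt1 := prime_gt1 (pcharf_prime pT).
have sNX : {subset N <= X} by move=> y Ny; rewrite eX adjoin_base.
have sNX' : {subset N' <= X'} by move=> y Ny; rewrite eX' adjoin_base.
have [sNM sMX _ _] := max_piP pT sNX; have [sNM' sMX' _ _] := max_piP pT' sNX'.
apply: (expnI p_gt1); apply: ext_degree_uniq (degree_pi H' eX') _.
apply: (ext_degree_morph bij_phi sMX sMX' sNM' phiN _ (degree_pi H eX)) => x.
apply/idP/idP => [/(mem_max_pi pT _ sNX)|/(mem_max_pi pT' _ sNX')] [_ [k Nk]].
  apply/(mem_max_pi pT' _ sNX'); split; first exact: fld_valP; exists k.
  by rewrite -!rmorphXn -phiN rmorphXn.
apply/(mem_max_pi pT _ sNX); split; first exact: fld_valP; exists k.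
by rewrite -rmorphXn phiN !rmorphXn.
Qed.

Theorem theorem3p8 (T : closedFieldType) (p : nat) (K : divringClosed T)
    (theta : T) (f fsep : {poly fld K}) (n : nat) (N : divringClosed T)
    (H : setting p theta f fsep n N) :
  let s := sep_degree fsep in
  let lam := sep_coef fsep in
  let L := adjoin1 K theta in
  let Lsep := max_sep K L in
  let Lpi := max_pi p K L in
  let NL := compositum N L in
  let NLsep := max_sep N NL in
  let NLpi := max_pi p N NL in
  let m1 := m_base p s n lam N in
  let m2 := m_ext p s n lam N NL in
  let E := compositum NLpi NLsep in
  (* item 1 *)
  [/\ [/\ NLsep =i compositum N Lsep,
          NLsep =i adjoin1 N (theta ^+ (p ^ (n - m1))),
          presented_by N (root_poly p s lam m1)
            (theta ^+ (p ^ (n - m1))) NLsep,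
          ext_degree N (compositum N Lsep) s
        & size (root_poly p s lam m1) = s.+1],
  (* item 2 *)
      [/\ [/\ NLpi =i adjoin_roots p s lam N (m1 + m2),
              {subset compositum N Lpi <= NLpi},
              compositum N Lpi =i
                adjoin_roots p s lam N
                  (m_base p s n lam K + m_ext p s n lam K L)
            & {subset adjoin_roots p s lam N m1 <= compositum N Lpi}],
          ext_degree N NLpi (p ^ m2),
          is_max (fun m' => (m' <= n - m1)%N /\
                    theta ^+ (p ^ (n - m1 - m')) \in E) m2,
          is_max (fun m' => (m' <= n - m1)%N /\
                    forall y, y \in NL -> y ^+ (p ^ (n - m1 - m')) \in E) m2
        & forall (T' : closedFieldType) (p' : nat) (K' : divringClosed T')
            (theta' : T') (f' fsep' : {poly fld K'}) (n' : nat)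
            (N' : divringClosed T') (H' : setting p' theta' f' fsep' n' N'),
            let NL' := compositum N' (adjoin1 K' theta') in
            forall phi : {rmorphism fld NL -> fld NL'},
              bijective phi ->
              (forall x : fld NL, (val x \in N) = (val (phi x) \in N')) ->
              m_ext p' (sep_degree fsep') n' (sep_coef fsep') N' NL' = m2],
  (* item 3 *)
      [/\ natural_tensor_iso N NLpi NLsep E,
          E =i adjoin1 NLpi (theta ^+ (p ^ (n - m1 - m2))),
          presented_by NLpi (root_poly p s lam (m1 + m2))
            (theta ^+ (p ^ (n - m1 - m2))) E,
          ext_degree NLpi E s
        & ext_degree NLsep E (p ^ m2)],
  (* item 4 *)
      [/\ NL =i adjoin1 E theta,
          presented_by E
            ('X^(p ^ (n - m1 - m2)) - (theta ^+ (p ^ (n - m1 - m2)))%:P)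
            theta NL,
          ext_degree E NL (p ^ (n - m1 - m2)),
          purely_insep_ext p E NL
        & pi_exponent p E NL (n - m1 - m2)]
  (* item 5 *)
    & max_sep NLpi NL =i E].
Proof.
move=> s lam L Lsep Lpi NL NLsep NLpi m1 m2 E.
have eNL : NL =i adjoin1 N theta := compositum_adjoin1 theta (setting_N_ext H).
split.
- split; first exact: max_sep_base H eNL.
  + exact: max_sep_alpha H eNL.
  + exact: presented_sep H eNL.
  + exact: ext_degree_eq (max_sep_base H eNL) (degree_sep H eNL).
  + exact: size_root_poly H _.
- split.
  + split; first exact: max_pi_roots H eNL.
    * exact: max_pi_base_sub H eNL.
    * exact: max_pi_base H.
    * by move=> y /(adjoin_roots_base H); apply: compositum_l.
  + exact: degree_pi H eNL.
  + exact: m_ext_theta_max H eNL.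
  + exact: m_ext_exp_max H eNL.
  + move=> T' p' K' theta' f' fsep' n' N' H' NL' phi bij_phi phiN.
    have eNL' := compositum_adjoin1 theta' (setting_N_ext H').
    exact: m_ext_invariant H H' eNL eNL' bij_phi phiN.
- split; first exact: tensor_iso_compositum H eNL.
  + exact: compositum_beta H eNL.
  + exact: presented_compositum H eNL.
  + exact: degree_pi_compositum H eNL.
  + exact: degree_sep_compositum H eNL.
- split; first exact: adjoin_compositum H eNL.
  + exact: presented_top H eNL.
  + exact: degree_top H eNL.
  + have [exp_top _] := exponent_top H eNL.
    by move=> y /exp_top; exists (n - m1 - m2)%N.
  + exact: exponent_top H eNL.
- exact: max_sep_pi H eNL.
Qed.
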